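(* Let $P\subset\mathbb{R}^d$ be a rational $d$-polytope with denominator $q$, let $h^*(P;z)=\sum_{j=0}^{q(d+1)-1}h^*_jz^j$ be defined by $\mathrm{Ehr}(P;z)=\frac{h^*(P;z)}{(1-z^q)^{d+1}}$, and let $s=\deg h^*(P;z)$. Then $$h^*_0+\cdots+h^*_{i+1}\ge h^*_{q(d+1)-1}+\cdots+h^*_{q(d+1)-1-i}\quad\text{for } i=0,\dots,\left\lfloor\tfrac{q(d+1)-1}{2}\right\rfloor-1,$$ and $$h^*_s+\cdots+h^*_{s-i}\ge h^*_0+\cdots+h^*_i\quad\text{for } i=0,\dots,q(d+1)-1.$$
   Context: The denominator $q$ of $P$ is the lcm of all denominators of the vertex coordinates of $P$; $\mathrm{Ehr}(P;z)=\sum_{t\ge0}|tP\cap\mathbb{Z}^d|z^t$. By convention $h^*_j=0$ for $j<0$ or $j>s$. *)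

(* Defs.v *)
From mathcomp Require Export all_boot all_order all_algebra.
From mathcomp Require Export finmap all_classical reals.

Set Implicit Arguments.
Unset Strict Implicit.
Unset Printing Implicit Defensive.

Import Order.TTheory GRing.Theory Num.Theory.
Local Open Scope classical_set_scope.
Local Open Scope ring_scope.

Section Polytopes.
Variables (R : realType) (d : nat).
Implicit Types (A P : set 'rV[R]_d) (x v : 'rV[R]_d).

Definition affine_hull A : set 'rV[R]_d :=
  [set x | exists (n : nat) (p : 'I_n -> 'rV[R]_d) (w : 'I_n -> R),
     [/\ forall i, A (p i), \sum_(i < n) w i = 1
       & x = \sum_(i < n) w i *: p i]].

Definition convex_hull A : set 'rV[R]_d :=
  [set x | exists (n : nat) (p : 'I_n -> 'rV[R]_d) (w : 'I_n -> R),
     [/\ forall i, A (p i), forall i, 0 <= w i, \sum_(i < n) w i = 1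
       & x = \sum_(i < n) w i *: p i]].

(* The affine hull of A is a translate of a k-dimensional linear subspace. *)
Definition has_dim A (k : nat) : Prop :=
  exists (p : 'rV[R]_d) (B : 'M[R]_(k, d)),
    row_free B /\ affine_hull A = [set x | (x - p <= B)%MS].

Definition polytope P : Prop := exists2 A, finite_set A & P = convex_hull A.

(* Vertices are the extreme points. *)
Definition vertices P : set 'rV[R]_d :=
  [set v | P v /\ forall x y (t : R), P x -> P y -> 0 < t < 1 ->
     v = (1 - t) *: x + t *: y -> x = v /\ y = v].

Definition rational_polytope P : Prop :=
  polytope P /\
  forall v, vertices P v -> forall i, exists r : rat, v 0 i = ratr r.

Definition dilate (t : nat) P : set 'rV[R]_d := [set t%:R *: x | x in P].

Definition int_lattice : set 'rV[R]_d :=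
  [set x | forall i, x 0 i \is a Num.int].

Definition lattice_count P (t : nat) : nat :=
  #|` fset_set (dilate t P `&` int_lattice)|.

End Polytopes.

Arguments int_lattice {R d}.

(* Denominator in lowest terms; meaningful only when x is rational. *)
Definition real_denom (R : realType) (x : R) : nat :=
  absz (denq (xget (0 : rat) [set r : rat | ratr r = x])).

(* The big operator over a set of vectors is the finitely supported one, which
   is the ordinary lcm here because a polytope has finitely many vertices. *)
Definition denominator (R : realType) (d : nat) (P : set 'rV[R]_d) : nat :=
  \big[lcmn/1%N]_(v \in vertices P) \big[lcmn/1%N]_(i < d) real_denom (v 0 i).

(* Formal power series with integer coefficients, as coefficient sequences. *)
Definition series_mul (a b : nat -> int) (n : nat) : int :=
  \sum_(k < n.+1) a k * b (n - k)%N.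

Definition poly_series (p : {poly int}) (n : nat) : int := p`_n.

Definition ehrhart_series (R : realType) (d : nat) (P : set 'rV[R]_d)
    (t : nat) : int := (lattice_count P t)%:Z.

(* Ehr(P; z) = h(z) / (1 - z^q)^(d+1), written without division: the
   denominator has constant term 1, so it is invertible and h is unique. *)
Definition is_hstar (R : realType) (d : nat) (P : set 'rV[R]_d) (q : nat)
    (h : {poly int}) : Prop :=
  (size h <= q * d.+1)%N /\
  series_mul (ehrhart_series P) (poly_series ((1 - 'X^q) ^+ d.+1)) =1
    poly_series h.

(* Coefficients indexed by int, with value 0 outside the range 0, ..., deg h. *)
Definition hcoef (h : {poly int}) (j : int) : int :=
  if j is Posz n then h`_n else 0.

(* Main.v *)
Require Import Defs.
From mathcomp Require Import lra ring zify.

(** Let [C] be the cone over [P] in dimension [d + 1], generated by the vectors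
    [(q v, q)] for the vertices [v] of [P], and let [a] be a lattice point in the
    interior of [C] of least height [l]. For a point [x], the depth of [x] is the
    largest [c] with [x - c a] in [C]; modulo [a], the boundary of [C] becomes a
    complete fan. Minimising a generic perturbation of [- c] over the ways to
    write [x] as [c a] plus a nonnegative combination of the generators
    triangulates this fan (the cells are the optimal bases of the linear program),
    and a generic direction [g] makes the simplicial cells half-open, so that they
    partition the space; replacing [g] by [- g] exchanges closed and open facets.
    Consequently the generating functions of the lattice points of depth [0] and
    of depth in [(0, 1)] are [B0 / (1 - z^q)^d] and [B1 / (1 - z^q)^d], where [B0]
    and [B1] count lattice points in half-open boxes: their coefficients are
    nonnegative, and the central symmetry of the boxes gives
    [B0(z) = z^(qd) B0(1/z)] and [B1(z) = z^(qd+l) B1(1/z)].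
    Since [C] is the disjoint union of these two layers and of [a + C],
    [h(z) (1 - z^l) = (B0 + B1) (1 - z^q)]. With [m = q (d + 1)] the symmetries
    then give [h(z) - z^m h(1/z) = (1 - z^q) B0] and
    [z^m h(1/z) - z^l h(z) = (1 - z^q) B1]. Dividing by [1 - z] yields both
    families of inequalities, because [s = m - l]. *)

Set Implicit Arguments.
Unset Strict Implicit.
Unset Printing Implicit Defensive.

Import Order.TTheory GRing.Theory Num.Theory.
Local Open Scope classical_set_scope.
Local Open Scope ring_scope.

(** * Bases and genericity *)

Section Bases.
Variables (R : realFieldType) (V : lmodType R) (I : finType) (e : I -> V).
Implicit Types (mu nu : I -> R) (S T : {set I}) (u v : V).

Definition comb mu : V := \sum_i mu i *: e i.
Definition supported S mu := forall i, i \notin S -> mu i = 0.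
Definition spanning S := forall v, exists2 mu, supported S mu & v = comb mu.
Definition independent S :=
  forall mu, supported S mu -> comb mu = 0 -> forall i, mu i = 0.
Definition is_basis S := spanning S /\ independent S.
(** The expansion is picked by [xget], with the zero function as default; for a basis [S] it is the
    only one and is linear in [v]. *)
Definition coords S v : I -> R :=
  xget (fun=> 0) [set mu | supported S mu /\ v = comb mu].

Lemma combD a mu nu : comb (fun i => a * mu i + nu i) = a *: comb mu + comb nu.
Proof.
rewrite /comb scaler_sumr -big_split /=; apply: eq_bigr => i _.
by rewrite scalerDl scalerA.
Qed.

Lemma comb1 j : comb (fun i => (i == j)%:R) = e j.
Proof.
rewrite /comb (bigD1 j) //= eqxx scale1r big1 ?addr0 // => i /negPf ->.
by rewrite scale0r.
Qed.

Lemma supportedD S a mu nu : supported S mu -> supported S nu ->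
  supported S (fun i => a * mu i + nu i).
Proof. by move=> hm hn i iS; rewrite hm // hn // mulr0 addr0. Qed.

Lemma supported1 S j : j \in S -> supported S (fun i => (i == j)%:R).
Proof. by move=> jS i; case: eqP => // ->; rewrite jS. Qed.

Lemma coordsP S v : is_basis S ->
  supported S (coords S v) /\ v = comb (coords S v).
Proof.
move=> [sp _]; have [mu h1 h2] := sp v.
exact: (@xgetPex _ (fun=> 0) [set mu | supported S mu /\ v = comb mu]
  (ex_intro _ mu (conj h1 h2))).
Qed.

Lemma coords_supported S v i : is_basis S -> i \notin S -> coords S v i = 0.
Proof. by move=> /(coordsP v)[h _]; exact: h. Qed.

Lemma comb_coords S v : is_basis S -> comb (coords S v) = v.
Proof. by move=> /(coordsP v)[_ <-]. Qed.

Lemma coords_unique S mu i : is_basis S -> supported S mu ->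
  coords S (comb mu) i = mu i.
Proof.
move=> bS sm; have [sc hc] := coordsP (comb mu) bS.
have := bS.2 _ (supportedD (-1) sm sc).
rewrite combD -hc scaleN1r addNr => /(_ erefl i) /eqP.
by rewrite mulN1r addrC subr_eq0 => /eqP.
Qed.

Lemma coords_linear S a u v i : is_basis S ->
  coords S (a *: u + v) i = a * coords S u i + coords S v i.
Proof.
move=> bS; have [su hu] := coordsP u bS; have [sv hv] := coordsP v bS.
by rewrite {1}hu {1}hv -combD coords_unique //; apply: supportedD.
Qed.

Lemma coords0 S i : is_basis S -> coords S 0 i = 0.
Proof.
move=> bS; have := coords_linear 1 0 0 i bS.
by rewrite scale1r addr0 mul1r => h; move: h; lra.
Qed.

Lemma coordsD S u v i : is_basis S ->
  coords S (u + v) i = coords S u i + coords S v i.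
Proof. by move=> bS; rewrite -(scale1r u) coords_linear // mul1r scale1r. Qed.

Lemma coordsZ S a u i : is_basis S -> coords S (a *: u) i = a * coords S u i.
Proof. by move=> bS; rewrite -[_ *: _]addr0 coords_linear // coords0 // addr0. Qed.

Lemma coordsN S u i : is_basis S -> coords S (- u) i = - coords S u i.
Proof. by move=> bS; rewrite -scaleN1r coordsZ // mulN1r. Qed.

Lemma coords_sum S (K : Type) (r : seq K) (p : pred K) (F : K -> V) i :
  is_basis S ->
  coords S (\sum_(k <- r | p k) F k) i = \sum_(k <- r | p k) coords S (F k) i.
Proof.
move=> bS; elim/big_rec2 : _; first by rewrite coords0.
by move=> k y1 y2 _ <-; rewrite coordsD.
Qed.

Lemma coords_comb S mu i : is_basis S ->
  coords S (comb mu) i = \sum_j mu j * coords S (e j) i.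
Proof.
by move=> bS; rewrite /comb coords_sum //; apply: eq_bigr => j _; rewrite coordsZ.
Qed.

Lemma coords_e S i j : is_basis S -> j \in S -> coords S (e j) i = (i == j)%:R.
Proof. by move=> bS jS; rewrite -comb1 coords_unique //; apply: supported1. Qed.

Lemma exchange_basis S i j : is_basis S -> i \in S -> j \notin S ->
  coords S (e j) i != 0 -> is_basis (j |: S :\ i).
Proof.
move=> bS iS jS k0; set k := coords S (e j) in k0 *.
have ij : i != j by apply: contraNneq jS => <-.
have hk : comb k = e j by exact: comb_coords.
have ks l : l \notin S -> k l = 0 by exact: coords_supported.
split.
  move=> v; set c := coords S v.
  (* Pivoting: since [comb k = e j], the bracket is a relation among the generators, and the factor
     [c i / k i] makes it cancel the coefficient at [i]. *)
  exists (fun l => c i / k i * (- k l + (l == j)%:R) + c l).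
    move=> l; rewrite !inE negb_or negb_and negbK => /andP[lj /orP[/eqP ->|lS]].
      by rewrite (negPf ij) addr0 mulrN divfK // addNr.
    by rewrite (negPf lj) (ks l) // /c (coords_supported v bS lS) oppr0 !addr0 mulr0.
  have -> : v = c i / k i *: (-1 *: comb k + comb (fun l => (l == j)%:R)) + comb c.
    by rewrite hk comb1 scaleN1r addNr scaler0 add0r comb_coords.
  rewrite -combD -combD; congr comb; apply: funext => l; ring.
move=> nu sn hn.
(* Replacing [e j] by its expansion [k] turns the relation [nu] into one on [S]; at [i] it reads
   [nu j * k i = 0]. *)
have s1 : supported S (fun l => nu j * (k l - (l == j)%:R) + nu l).
  move=> l lS; have [->|lj] := eqVneq l j; first by rewrite ks // add0r mulrN1 addNr.
  by rewrite ks // subrr mulr0 add0r sn // !inE (negPf lj) (negPf lS) andbF.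
have nui : nu i = 0 by rewrite sn // !inE eqxx (negPf ij).
have h0 l : nu j * (k l - (l == j)%:R) + nu l = 0.
  apply: (bS.2 _ s1).
  have -> : (fun l => nu j * (k l - (l == j)%:R) + nu l) =
    (fun l => nu j * (- 1 * (l == j)%:R + k l) + nu l).
    by apply: funext => l'; ring.
  by rewrite combD combD comb1 hk scaleN1r addNr scaler0 add0r.
have : nu j = 0.
  move: (h0 i); rewrite nui (negPf ij) subr0 addr0 => /eqP.
  by rewrite mulf_eq0 (negPf k0) orbF => /eqP.
by move=> nj l; have := h0 l; rewrite nj mul0r add0r.
Qed.

(** A smallest spanning set containing [T] is independent: a nontrivial relation on it involves some
    [j] outside [T], and that [j] could be eliminated. *)
Lemma independent_extend T : spanning [set: I]%SET -> independent T ->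
  exists2 S : {set I}, is_basis S & T \subset S.
Proof.
move=> spT indT.
pose Q (S : {set I}) := `[< spanning S >] && (T \subset S).
have P0 : Q [set: I]%SET.
  by rewrite /Q finset.subsetT andbT; apply/asboolP.
have [S /andP[/asboolP spS TS] Smin] :=
  @arg_minnP _ _ Q (fun S : {set I} => #|S|) P0.
exists S => //; split => // mu smu mu0 i; apply/eqP/negPn/negP => mui.
have iS : i \in S by apply: contraTT mui => /smu ->; rewrite eqxx.
have [[j [jS jT muj]]|noj] :=
  pselect (exists j, [/\ j \in S, j \notin T & mu j != 0]); last first.
  have sT : supported T mu.
    move=> j jT; apply/eqP/negPn/negP => muj; apply: noj; exists j; split => //.
    by apply: contraTT muj => /smu ->; rewrite eqxx.
  by move: mui; rewrite (indT _ sT mu0) eqxx.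
have : (#|S| <= #|S :\ j|)%N.
  apply: Smin; rewrite /Q finset.subsetD1 TS jT !andbT; apply/asboolP => v.
  have [nu snu ->] := spS v.
  exists (fun l => - (nu j / mu j) * mu l + nu l).
    move=> l; rewrite !inE negb_and negbK => /orP[/eqP ->|lS].
      by rewrite mulNr divfK // addNr.
    by rewrite (smu _ lS) (snu _ lS) mulr0 addr0.
  by rewrite combD mu0 scaler0 add0r.
by rewrite [X in (X <= _)%N](cardsD1 j) jS ltnn.
Qed.

End Bases.

(** * Generic points and small perturbations *)

Section Genericity.
Variable R : realFieldType.

(** On the moment curve each linear form becomes a nonzero polynomial in [t], and the product of
    these has fewer roots than the [size P] values of [t] tried. *)
Lemma avoid_hyperplanes (I K : finType) (A : pred K) (a : K -> I -> R) :
  (forall k, A k -> exists i, a k i != 0) ->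
  exists x : I -> R, forall k, A k -> \sum_i a k i * x i != 0.
Proof.
move=> ha.
pose p k : {poly R} := \sum_i a k i *: 'X^(enum_rank i).
have p0 k : A k -> p k != 0.
  move=> /ha[i ki]; apply: contraNneq ki => pk.
  have : (p k)`_(enum_rank i) = 0 by rewrite pk coef0.
  rewrite coef_sum (bigD1 i) //= coefZ coefXn eqxx mulr1 big1 ?addr0 => [->//|j ji].
  rewrite coefZ coefXn; case: eqP => [/ord_inj/enum_rank_inj ij|]; last by rewrite mulr0.
  by rewrite ij eqxx in ji.
have P0 : \prod_(k | A k) p k != 0 by apply/prodf_neq0 => k; exact: p0.
set P := \prod_(k | A k) p k in P0.
pose s := [seq (n%:R : R) | n <- iota 0 (size P)].
have us : uniq s.
  by rewrite map_inj_uniq ?iota_uniq // => m n /eqP; rewrite eqr_nat => /eqP.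
have /allPn[t _ nt] : ~~ all (root P) s.
  apply/negP => hs; have := max_poly_roots P0 hs us.
  by rewrite size_map size_iota ltnn.
exists (fun i => t ^+ enum_rank i) => k Ak; apply: contraNneq nt => h0.
rewrite /P (bigD1 k) //= rootM; apply/orP; left; apply/rootP.
by rewrite horner_sum -[RHS]h0; apply: eq_bigr => i _; rewrite hornerZ hornerXn.
Qed.

Lemma small_perturbation (K : finType) (a b : K -> R) :
  exists2 x : R, 0 < x & forall k,
    (0 < a k -> 0 < a k + x * b k) /\ (a k < 0 -> a k + x * b k < 0).
Proof.
(* Larger than every ratio of [b k] to a nonzero [a k]; where [a k = 0] the summand is [0] and
   nothing is claimed. *)
pose M := 1 + \sum_k `|b k| / `|a k|.
have M0 : 0 < M.
  by apply: ltr_wpDr => //; apply: sumr_ge0 => k _; exact: divr_ge0.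
exists M^-1; rewrite ?invr_gt0 // => k.
have key : a k != 0 -> `|M^-1 * b k| < `|a k|.
  move=> ak; rewrite normrM gtr0_norm ?invr_gt0 // ltr_pdivrMl //.
  rewrite -ltr_pdivrMr ?normr_gt0 // /M (bigD1 k) //=.
  rewrite addrCA ltrDl; apply: ltr_wpDr => //.
  by apply: sumr_ge0 => j _; exact: divr_ge0.
split=> ak.
  by have := key (lt0r_neq0 ak); rewrite (gtr0_norm ak) ltr_norml => /andP[]; lra.
by have := key (ltr0_neq0 ak); rewrite (ltr0_norm ak) ltr_norml => /andP[]; lra.
Qed.

End Genericity.

(** * A half-open fan from linear programming *)

(* [c + x * s > 0] for all sufficiently small [x > 0]. *)
Definition lexpos (R : realFieldType) (s c : R) :=
  (0 < c) || ((c == 0) && (0 < s)).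

Section Fan.
Variables (R : realFieldType) (V : lmodType R) (I : finType) (e : I -> V).
Variable o : I.
Implicit Types (mu nu w : I -> R) (S T : {set I}) (u v y g : V).

(** The coefficient at [o] is free: modulo [e o] the other generators span positively, which makes
    the fan complete. *)
Hypothesis pos_span :
  forall v, exists2 mu, (forall i, i != o -> 0 <= mu i) & v = comb e mu.
Hypothesis pointed :
  forall mu, (forall i, 0 <= mu i) -> comb e mu = 0 -> forall i, mu i = 0.

(** Carathéodory's argument: a smallest [T] containing [o] that supports an admissible expansion of
    [y] is independent, and it extends to a basis. *)
Lemma feasible_basis y : exists S,
  [/\ is_basis e S, o \in S & forall i, i != o -> 0 <= coords e S y i].
Proof.
pose good T := exists mu,
  [/\ supported T mu, forall i, i != o -> 0 <= mu i & y = comb e mu].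
pose Q T := (o \in T) && `[< good T >].
have Q0 : Q [set: I]%SET.
  rewrite /Q finset.in_setT; apply/asboolP; have [mu h1 h2] := pos_span y.
  by exists mu; split => // i; rewrite finset.in_setT.
have [T /andP[oT /asboolP[mu [smu mu0 ymu]]] Tmin] :=
  @arg_minnP _ _ Q (fun S : {set I} => #|S|) Q0.
(* A relation with a positive coefficient off [o] would, by the ratio test, remove an index [k] from
   [T]. *)
have noT nu i : supported T nu -> comb e nu = 0 -> i != o -> ~ 0 < nu i.
  move=> snu nu0 io nui.
  pose p i := (i != o) && (0 < nu i).
  have pi : p i by rewrite /p io.
  have [k /andP[ko nuk] kmin] := @Order.TotalTheory.arg_minP _ _ _ i p
    (fun i => mu i / nu i) pi.
  have : (#|T| <= #|T :\ k|)%N.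
    apply: Tmin; rewrite /Q !inE eq_sym ko oT; apply/asboolP.
    exists (fun l => - (mu k / nu k) * nu l + mu l); split.
    - move=> l; rewrite !inE negb_and negbK => /orP[/eqP ->|lT].
        by rewrite mulNr divfK ?gt_eqF // addNr.
      by rewrite (snu _ lT) (smu _ lT) mulr0 addr0.
    - move=> l lo; rewrite mulNr addrC subr_ge0.
      have m0 : 0 <= mu k / nu k by rewrite divr_ge0 ?mu0 // ltW.
      have [nul|nul] := ltP 0 (nu l).
        by rewrite -ler_pdivlMr //; apply: kmin; rewrite /p lo.
      by apply: le_trans (mu0 _ lo); rewrite mulr_ge0_le0.
    - by rewrite combD nu0 scaler0 add0r.
  have kT : k \in T by apply: contraTT nuk => /snu ->; rewrite ltxx.
  by rewrite [X in (X <= _)%N](cardsD1 k) kT ltnn.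
have indT : independent e T.
  move=> nu snu nu0.
  have nuo i : i != o -> nu i = 0.
    move=> io; apply/eqP; rewrite eq_le; apply/andP; split.
      by rewrite leNgt; apply/negP; exact: (noT nu i).
    rewrite -oppr_le0 leNgt; apply/negP.
    have := noT (fun l => - 1 * nu l + 0) i; rewrite mulN1r addr0; apply => //.
      by move=> l lT; rewrite (snu _ lT) mulr0 addr0.
    rewrite combD nu0 scaler0 add0r /comb big1 // => l _; exact: scale0r.
  (* Only [e o] is left in the relation, so its sign can be changed freely and [pointed] applies to
     the absolute values. *)
  have : comb e (fun i => `|nu i|) = 0.
    have hc : comb e nu = nu o *: e o.
      rewrite /comb (bigD1 o) //= big1 ?addr0 // => l lo.
      by rewrite nuo // scale0r.
    have -> : comb e (fun i => `|nu i|) = `|nu o| *: e o.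
      rewrite /comb (bigD1 o) //= big1 ?addr0 // => l lo.
      by rewrite nuo // normr0 scale0r.
    move: nu0; rewrite hc => h; have [_|_] := ger0P (nu o) => //.
    by rewrite scaleNr h oppr0.
  move=> /(pointed (fun i => normr_ge0 (nu i))) h i.
  by apply/eqP; rewrite -normr_eq0 h.
have spT : spanning e [set: I]%SET.
  move=> v; have [nu _ ->] := pos_span v; exists nu => // i.
  by rewrite finset.in_setT.
have [S bS TS] := independent_extend spT indT.
exists S; split => //; first exact: (fintype.subsetP TS _ oT).
move=> i io; rewrite ymu coords_unique ?mu0 // => j jS; apply: smu.
by apply: contra jS => /(fintype.subsetP TS).
Qed.

(** The reduced cost of linear programming: what the objective gains when one unit of [e j] replaces
    its expansion over [S]. *)
Definition rcost w S j := w j - \sum_i coords e S (e j) i * w i.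

Definition lp_basis S := is_basis e S /\ o \in S.

(* [w] is [- 1] at [o] plus a small generic perturbation; only these
   consequences matter. *)
Definition generic_weight w := forall S j, lp_basis S -> j \notin S ->
  [/\ rcost w S j != 0,
      (forall i, i != o -> coords e S (e j) i <= 0) -> 0 < rcost w S j
    & 0 < rcost w S j -> 0 <= coords e S (e j) o].

Lemma exists_generic_weight : exists w, generic_weight w.
Proof.
pose A (k : {set I} * I) := `[< lp_basis k.1 >] && (k.2 \notin k.1).
pose a (k : {set I} * I) i : R := (i == k.2)%:R - coords e k.1 (e k.2) i.
have [k|x hx] := @avoid_hyperplanes R I _ A a.
  move=> /andP[/asboolP[bS oS] jS]; exists k.2.
  by rewrite /a eqxx coords_supported // subr0 oner_neq0.
have rE w S j : rcost w S j = \sum_i a (S, j) i * w i.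
  rewrite /rcost /a /=; under [RHS]eq_bigr do rewrite mulrBl.
  rewrite sumrB; congr (_ - _); rewrite (bigD1 j) //= eqxx mul1r big1 ?addr0 //.
  by move=> i /negPf ->; rewrite mul0r.
have [d d0 hd] := small_perturbation
  (fun k : {set I} * I => coords e k.1 (e k.2) o)
  (fun k : {set I} * I => \sum_i a k i * x i).
exists (fun i => - (i == o)%:R + d * x i) => S j [bS oS] jS.
have hx1 : \sum_i a (S, j) i * x i != 0.
  by apply: hx; rewrite /A jS andbT; apply/asboolP.
have jo : j != o by apply: contraNneq jS => ->.
have {}rE : rcost (fun i => - (i == o)%:R + d * x i) S j =
    coords e S (e j) o + d * \sum_i a (S, j) i * x i.
  rewrite rE; under eq_bigr do rewrite mulrDr mulrCA.
  rewrite big_split /= -mulr_sumr; congr (_ + _).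
  rewrite (bigD1 o) //= big1 => [|i /negPf ->]; last by rewrite oppr0 mulr0.
  by rewrite /a /= eqxx eq_sym (negPf jo) addr0 sub0r mulrN1 opprK.
have [/= hp hn] := hd (S, j); rewrite {}rE; split.
- case: (ltgtP (coords e S (e j) o) 0) => [/hn/ltr0_neq0|/hp/lt0r_neq0|->] //.
  by rewrite add0r mulf_neq0 // gt_eqF.
(* If the coordinate at [o] were not positive either, subtracting the expansion from [e j] would
   give a nonnegative relation with coefficient [1] at [j]. *)
- move=> h; apply: hp; rewrite ltNge; apply/negP => ko.
  pose mu i := - coords e S (e j) i + (i == j)%:R.
  have /(_ j) : forall i, mu i = 0.
    apply: pointed.
      move=> i; rewrite /mu addr_ge0 ?ler0n // oppr_ge0.
      by have [->|/h] := eqVneq i o.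
    have -> : mu = fun i => - 1 * coords e S (e j) i + (i == j)%:R.
      by apply: funext => i; rewrite mulN1r.
    by rewrite combD comb1 comb_coords // scaleN1r addNr.
  by rewrite /mu eqxx coords_supported // oppr0 add0r => /eqP; rewrite oner_eq0.
- by move=> r0; rewrite leNgt; apply/negP => /hn; rewrite ltNge ltW.
Qed.

Definition optimal w S := lp_basis S /\ forall j, j \notin S -> 0 < rcost w S j.

(** Avoidance of every hyperplane spanned by a basis through [e o] with one other member removed;
    these contain all walls of the fan. *)
Definition nondegenerate y :=
  forall S i, lp_basis S -> i \in S -> i != o -> coords e S y i != 0.

(* One pivot of the simplex method improves any feasible basis that is not
   dual feasible. *)
Lemma optimal_exists w y : generic_weight w -> nondegenerate y ->
  exists2 S, optimal w S & forall i, i \in S -> i != o -> 0 < coords e S y i.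
Proof.
move=> gw ny.
pose Q S := `[< lp_basis S /\ forall i, i != o -> 0 <= coords e S y i >].
have [S0 [bS0 oS0 h0]] := feasible_basis y.
have Q0 : Q S0 by apply/asboolP.
pose cost S := \sum_i coords e S y i * w i.
have [S /asboolP[lS yS] Smin] := @Order.TotalTheory.arg_minP _ _ _ S0 Q cost Q0.
have [bS oS] := lS.
have ypos i : i \in S -> i != o -> 0 < coords e S y i.
  by move=> iS io; rewrite lt_neqAle eq_sym ny // yS.
exists S => //; split => // j jS.
have jo : j != o by apply: contraNneq jS => ->.
have [r0 rU _] := gw S j lS jS.
rewrite ltNge le_eqVlt (negPf r0) /=; apply/negP => rneg.
pose k := coords e S (e j); pose c := coords e S y.
pose p i := (i != o) && (0 < k i).
(* Without a positive entry off [o] in the column of [j], genericity would make its reduced cost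
   positive; so the ratio test has a candidate. *)
have [i0 pi0] : exists i, p i.
  apply: contrapT => hn; suff : 0 < rcost w S j by rewrite ltNge ltW.
  apply: rU => i io; rewrite leNgt; apply/negP => ki; apply: hn.
  by exists i; rewrite /p io.
have [i /andP[io ki] imin] := @Order.TotalTheory.arg_minP _ _ _ i0 p
    (fun i => c i / k i) pi0.
have iS : i \in S.
  by apply: contraTT ki => iS; rewrite /k coords_supported // ltxx.
have bS' : is_basis e (j |: S :\ i) by apply: exchange_basis; rewrite ?gt_eqF.
have ij : i != j by apply: contraNneq jS => <-.
pose t := c i / k i.
have t0 : 0 < t by rewrite divr_gt0 // ypos.
pose c' l := t * (- 1 * k l + (l == j)%:R) + c l.
have c'E : coords e (j |: S :\ i) y = c'.
  apply: funext => l.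
  have hy : y = comb e c'.
    by rewrite !combD comb1 !comb_coords // scaleN1r addNr scaler0 add0r.
  rewrite {1}hy coords_unique // => l'.
  rewrite !inE negb_or negb_and negbK /c' => /andP[lj /orP[/eqP ->|lS']].
    by rewrite (negPf ij) addr0 mulN1r mulrN divfK ?gt_eqF // addNr.
  rewrite (negPf lj) /k /c (coords_supported (e j) bS lS').
  by rewrite (coords_supported y bS lS') mulr0 !addr0 mulr0.
have lS' : lp_basis (j |: S :\ i).
  by split => //; rewrite !inE [o == i]eq_sym io oS orbT.
have : cost S <= cost (j |: S :\ i).
  apply: Smin; apply/asboolP; split => // l lo; rewrite c'E /c'.
  have cl : 0 <= c l by exact: yS.
  have [->|lj] := eqVneq l j.
    rewrite /k /c !(coords_supported _ bS jS) /=; lra.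
  rewrite addr0; have [kl|kl] := ltP 0 (k l); last by nra.
  have : t <= c l / k l by apply: imin; rewrite /p lo.
  by rewrite ler_pdivlMr //; lra.
(* The pivot changes the cost by [t * rcost w S j], which is negative, against the minimality of
   [S]. *)
rewrite /cost c'E -subr_ge0 -sumrB.
rewrite (eq_bigr (fun l => t * ((l == j)%:R * w l - k l * w l))); last first.
  by move=> l _; rewrite /c' /c; ring.
rewrite -mulr_sumr pmulr_rge0 // sumrB (bigD1 j) //= eqxx mul1r big1 ?addr0.
  by rewrite leNgt rneg.
by move=> l /negPf ->; rewrite mul0r.
Qed.

(** Duality with complementary slackness: the difference of the costs is the sum of
    [coords e S y j * rcost w S' j] over [S]. The reduced costs vanish on [S'] and are positive off
    it, so equality forces every [j] of [S] into [S']. *)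
Lemma optimal_cost w S S' y : lp_basis S -> optimal w S' ->
  (forall i, i \in S -> i != o -> 0 < coords e S y i) ->
  \sum_i coords e S' y i * w i <= \sum_i coords e S y i * w i
  /\ (\sum_i coords e S y i * w i <= \sum_i coords e S' y i * w i ->
      S \subset S').
Proof.
move=> [bS oS] [[bS' oS'] r'] ypos.
have rE j : j \in S' -> rcost w S' j = 0.
  move=> jS'; rewrite /rcost (bigD1 j) //= coords_e // eqxx mul1r big1 ?addr0 ?subrr //.
  by move=> i ij; rewrite coords_e // (negPf ij) mul0r.
have key : \sum_i coords e S y i * w i - \sum_i coords e S' y i * w i =
    \sum_(j in S) coords e S y j * rcost w S' j.
  have -> : \sum_i coords e S' y i * w i =
      \sum_j coords e S y j * \sum_i coords e S' (e j) i * w i.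
    rewrite -[X in coords e S' X](comb_coords y bS).
    under eq_bigr do rewrite coords_comb // mulr_suml.
    rewrite exchange_big /=; apply: eq_bigr => j _; rewrite mulr_sumr.
    by apply: eq_bigr => i _; rewrite mulrA.
  rewrite -sumrB [RHS]big_mkcond /=; apply: eq_bigr => j _; rewrite -mulrBr.
  by case: ifPn => // jS; rewrite coords_supported // mul0r.
have tpos j : j \in S -> 0 <= coords e S y j * rcost w S' j.
  move=> jS; have [jS'|jS'] := boolP (j \in S'); first by rewrite rE // mulr0.
  have jo : j != o by apply: contraNneq jS' => ->.
  by apply: mulr_ge0; apply: ltW; [exact: ypos|exact: r'].
split; first by rewrite -subr_ge0 key; exact: sumr_ge0.
rewrite -subr_le0 key => hle; apply/fintype.subsetP => j jS; apply: contraPT hle => jS'.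
apply/negP; rewrite -ltNge (bigD1 j) //=; apply: ltr_wpDr.
  by apply: sumr_ge0 => i /andP[iS _]; exact: tpos.
have jo : j != o by apply: contraNneq jS' => ->.
by apply: mulr_gt0; [exact: ypos|exact: r'].
Qed.

Lemma optimal_unique w S S' y : optimal w S -> optimal w S' ->
  (forall i, i \in S -> i != o -> 0 < coords e S y i) ->
  (forall i, i \in S' -> i != o -> 0 < coords e S' y i) -> S = S'.
Proof.
move=> oS oS' h h'.
have [h1 h2] := optimal_cost oS.1 oS' h.
have [h3 h4] := optimal_cost oS'.1 oS h'.
by apply/eqP; rewrite finset.eqEsubset h2 // h4.
Qed.

Lemma exists_nondegenerate : exists g, nondegenerate g.
Proof.
pose A (k : {set I} * I) := `[< lp_basis k.1 >] && (k.2 \in k.1).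
pose a (k : {set I} * I) i : R := coords e k.1 (e i) k.2.
have [k|x hx] := @avoid_hyperplanes R I _ A a.
  move=> /andP[/asboolP[bS oS] jS]; exists k.2.
  by rewrite /a coords_e // eqxx oner_neq0.
exists (comb e x) => S i lS iS io.
have := hx (S, i); rewrite /A /= iS andbT coords_comb; last exact: lS.1.
move=> /(_ (asboolT lS)); congr (_ != _).
by apply: eq_bigr => j _; rewrite mulrC.
Qed.

Lemma nondegenerateN g : nondegenerate g -> nondegenerate (- g).
Proof. by move=> hg S i lS iS io; rewrite coordsN ?oppr_eq0 ?hg //; exact: lS.1. Qed.

(** A half-open simplicial cone times the line through [e o]; facet [i] is included exactly when
    coordinate [i] of [g] is positive. *)
Definition cell g S v := forall i, i \in S -> i != o ->
  lexpos (coords e S g i) (coords e S v i).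

(* A vector in a half-open cell is one that is strictly inside after moving it
   slightly in the direction [g]. *)
Lemma cell_exists_unique w g v : generic_weight w -> nondegenerate g ->
  (exists2 S, optimal w S & cell g S v) /\
  (forall S S', optimal w S -> optimal w S' -> cell g S v -> cell g S' v ->
    S = S').
Proof.
move=> gw gg.
have [d d0 hd] := small_perturbation
  (fun k : {set I} * I => coords e k.1 v k.2)
  (fun k : {set I} * I => coords e k.1 g k.2).
have yE S i : is_basis e S ->
    coords e S (d *: g + v) i = coords e S v i + d * coords e S g i.
  by move=> bS; rewrite coords_linear // addrC.
split.
  have [||S oS hS] := @optimal_exists w (d *: g + v) => //.
    move=> S i lS iS io; rewrite yE; last exact: lS.1.
    have [/= hp hn] := hd (S, i).
    case: (ltgtP (coords e S v i) 0) => [/hn/ltr0_neq0|/hp/lt0r_neq0|->] //.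
    by rewrite add0r; apply: mulf_neq0; [rewrite gt_eqF|exact: gg].
  exists S => // i iS io; have := hS i iS io; rewrite yE; last exact: oS.1.1.
  have [/= hp hn] := hd (S, i); rewrite /lexpos.
  case: (ltgtP (coords e S v i) 0) => //=.
    by move=> /hn h /ltW; rewrite leNgt h.
  by move=> ->; rewrite add0r pmulr_rgt0.
move=> S S' oS oS' cS cS'; apply: (@optimal_unique w _ _ (d *: g + v)) => //.
  move=> i iS io; have [/= hp _] := hd (S, i); rewrite yE; last exact: oS.1.1.
  have /orP[/hp //|/andP[/eqP -> gp]] := cS i iS io.
  by rewrite add0r mulr_gt0.
move=> i iS io; have [/= hp _] := hd (S', i); rewrite yE; last exact: oS'.1.1.
have /orP[/hp //|/andP[/eqP -> gp]] := cS' i iS io.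
by rewrite add0r mulr_gt0.
Qed.

(** The third clause of genericity serves here: it makes the coordinate at [o] nonnegative on the
    whole cone, so that it can measure depth. *)
Lemma optimal_coord_ge0 w S j : generic_weight w -> optimal w S ->
  0 <= coords e S (e j) o.
Proof.
move=> gw [lS rS]; have [jS|jS] := boolP (j \in S).
  by rewrite coords_e ?ler0n //; exact: lS.1.
by have [_ _] := gw S j lS jS; apply; exact: rS.
Qed.

End Fan.

(** * Counting lattice points in the cells *)

Section FiniteCardinals.
Variable T : choiceType.
Implicit Types A B : set T.

Lemma card_fset_setU A B : finite_set A -> finite_set B ->
  (forall x, A x -> ~ B x) ->
  #|` fset_set (A `|` B)| = (#|` fset_set A| + #|` fset_set B|)%N.
Proof.
move=> fA fB AB; rewrite fset_setU // cardfsU -fset_setI //.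
have -> : A `&` B = set0 by apply/seteqP; split=> x // [/AB].
by rewrite fset_set0 cardfs0 subn0.
Qed.

Lemma card_fset_set_image (U : choiceType) (f : T -> U) A : injective f ->
  finite_set A -> #|` fset_set (f @` A)| = #|` fset_set A|.
Proof. by move=> fi fA; rewrite fset_set_image // card_imfset. Qed.

Lemma card_fset_set_bigcup (K : choiceType) (r : seq K) (A : K -> set T) :
  uniq r -> (forall k, k \in r -> finite_set (A k)) ->
  (forall j k x, j \in r -> k \in r -> A j x -> A k x -> j = k) ->
  finite_set [set x | exists2 k, k \in r & A k x] /\
  #|` fset_set [set x | exists2 k, k \in r & A k x]| =
    (\sum_(k <- r) #|` fset_set (A k)|)%N.
Proof.
elim: r => [_ _ _|j r IH /= /andP[jr ur] fA dA].
  have -> : [set x | exists2 k, k \in [::] & A k x] = set0.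
    by apply/seteqP; split=> x // [].
  by split; [exact: finite_set0|rewrite fset_set0 big_nil cardfs0].
have [||fr cr] := IH ur.
- by move=> k kr; apply: fA; rewrite inE kr orbT.
- by move=> k l x kr lr; apply: dA; rewrite inE ?kr ?lr orbT.
have -> : [set x | exists2 k, k \in j :: r & A k x] =
    A j `|` [set x | exists2 k, k \in r & A k x].
  apply/seteqP; split=> x /=.
    by move=> [k]; rewrite inE => /orP[/eqP -> ?|kr ?]; [left|right; exists k].
  by move=> [?|[k kr ?]]; [exists j|exists k]; rewrite // inE ?eqxx ?kr ?orbT.
have fj : finite_set (A j) by apply: fA; rewrite inE eqxx.
split; first by rewrite finite_setU.
rewrite card_fset_setU // ?big_cons ?cr // => x Ajx [k kr Akx].
have jk : j = k by apply: dA Ajx Akx; rewrite inE ?eqxx ?kr ?orbT.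
by rewrite jk kr in jr.
Qed.

End FiniteCardinals.

(** Multiplication by [1 - z^q] on coefficient sequences; indexing by [int] avoids a boundary
    case. *)
Definition diff (q : nat) (f : int -> int) (t : int) : int :=
  f t - f (t - q%:Z).

Lemma eq_iter_diff q n f g : f =1 g -> iter n (diff q) f =1 iter n (diff q) g.
Proof. by move=> fg; elim: n => //= n IH t; rewrite /diff !IH. Qed.

Lemma iter_diff_sum q n (K : Type) (r : seq K) (p : pred K)
    (F : K -> int -> int) t :
  iter n (diff q) (fun t => \sum_(k <- r | p k) F k t) t =
  \sum_(k <- r | p k) iter n (diff q) (F k) t.
Proof.
elim: n t => //= n IH t; rewrite /diff !IH -sumrB.
by apply: eq_bigr.
Qed.

(** Reflection exchanges lower and upper conditions on a coordinate once the direction is reversed,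
    that is, closed and open facets. *)
Lemma lexposN (R : realFieldType) (s c : R) : s != 0 ->
  lexpos s (- c) = ~~ lexpos (- s) c.
Proof.
rewrite /lexpos !oppr_gt0 oppr_eq0.
by case: (ltgtP c 0) => // _ /=; case: (ltgtP s 0).
Qed.

Lemma lexposD1 (R : realFieldType) (s c : R) : lexpos s c -> lexpos s (c + 1).
Proof. by rewrite /lexpos => h; apply/orP; left; move: h => /orP[|/andP[/eqP]]; lra. Qed.

Section Counting.
Variables (R : realFieldType) (V : lmodType R) (I : finType) (e : I -> V).
Variables (o : I) (L : set V) (ht : V -> R) (q l n : nat).
Implicit Types (S J : {set I}) (u v g : V) (A : set V) (X : set R) (t : int).

Definition cone : set V :=
  [set v | exists2 mu, (forall i, 0 <= mu i) & v = comb e mu].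

Hypothesis Le : forall i, L (e i).
Hypothesis L0 : L 0.
Hypothesis LB : forall u v, L u -> L v -> L (u - v).
Hypothesis htP : forall a u v, ht (a *: u + v) = a * ht u + ht v.
Hypothesis hte : forall i, i != o -> ht (e i) = q%:R.
Hypothesis hto : ht (e o) = l%:R.
Hypothesis q_gt0 : (0 < q)%N.
Hypothesis l_gt0 : (0 < l)%N.
Hypothesis pos_span :
  forall v, exists2 mu, (forall i, i != o -> 0 <= mu i) & v = comb e mu.
Hypothesis finite_slices :
  forall t, finite_set [set v | [/\ cone v, L v & ht v = t%:~R]].
Hypothesis card_basis : forall S, is_basis e S -> #|S| = n.+1.

Lemma htD u v : ht (u + v) = ht u + ht v.
Proof. by rewrite -{1}(scale1r u) htP mul1r. Qed.

Lemma ht0 : ht 0 = 0.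
Proof. by have := htD 0 0; rewrite addr0; lra. Qed.

Lemma htZ a u : ht (a *: u) = a * ht u.
Proof. by rewrite -[_ *: _]addr0 htP ht0 addr0. Qed.

Lemma htB u v : ht (u - v) = ht u - ht v.
Proof. by rewrite addrC -scaleN1r htP mulN1r addrC. Qed.

Lemma LD u v : L u -> L v -> L (u + v).
Proof. by move=> Lu Lv; rewrite -[v]opprK -[- v]sub0r; do 2?apply: LB. Qed.

Lemma ht_sum (K : Type) (r : seq K) (p : pred K) (F : K -> V) :
  ht (\sum_(k <- r | p k) F k) = \sum_(k <- r | p k) ht (F k).
Proof.
elim/big_rec2 : _; first exact: ht0.
by move=> k y1 y2 _ <-; rewrite htD.
Qed.

Lemma ht_e_gt0 i : 0 < ht (e i).
Proof.
by have [->|io] := eqVneq i o; rewrite ?hto ?hte // ltr0n.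
Qed.

(** All generators have positive height, and a vanishing combination has height [0]. *)
Lemma cone_pointed mu :
  (forall i, 0 <= mu i) -> comb e mu = 0 -> forall i, mu i = 0.
Proof.
move=> mu0 hmu i; have : ht (comb e mu) = 0 by rewrite hmu ht0.
rewrite /comb ht_sum => /eqP; rewrite psumr_eq0; last first.
  by move=> j _; rewrite htZ mulr_ge0 // ltW // ht_e_gt0.
move=> /allP /(_ i); rewrite mem_index_enum => /(_ isT) /=.
by rewrite htZ mulf_eq0 [ht _ == 0]gt_eqF ?ht_e_gt0 // orbF => /eqP.
Qed.

Lemma cone_ht_ge0 v : cone v -> 0 <= ht v.
Proof.
move=> [mu mu0 ->]; rewrite /comb ht_sum; apply: sumr_ge0 => i _.
by rewrite htZ mulr_ge0 // ltW // ht_e_gt0.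
Qed.

Lemma coneD u v : cone u -> cone v -> cone (u + v).
Proof.
move=> [mu mu0 ->] [nu nu0 ->]; exists (fun i => 1 * mu i + nu i).
  by move=> i; rewrite mul1r addr_ge0.
by rewrite combD scale1r.
Qed.

Lemma cone_e i : cone (e i).
Proof. by exists (fun j => (j == i)%:R); rewrite ?comb1 // => j; rewrite ler0n. Qed.

Lemma coneZ a v : 0 <= a -> cone v -> cone (a *: v).
Proof.
move=> a0 [mu mu0 ->]; exists (fun i => a * mu i + 0 * mu i).
  by move=> i; rewrite mul0r addr0 mulr_ge0.
rewrite (combD e a mu (fun i => 0 * mu i)) [X in _ + X]big1 ?addr0 // => i _.
by rewrite mul0r scale0r.
Qed.

Definition slice A t : set V := A `&` [set v | L v /\ ht v = t%:~R].
(** [fset_set] is faithful only on finite sets, hence the requirement below that the sets counted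
    lie in [cone]. *)
Definition cnt A t : int := (#|` fset_set (slice A t)|)%:Z.

Lemma finite_slice A t : A `<=` cone -> finite_set (slice A t).
Proof.
move=> AC; apply: sub_finite_set (finite_slices t) => v [/AC ? [? ?]].
by split.
Qed.

Lemma cntU A B t : A `<=` cone -> B `<=` cone -> (forall v, A v -> ~ B v) ->
  cnt (A `|` B) t = cnt A t + cnt B t.
Proof.
move=> AC BC AB; rewrite /cnt /slice setIUl card_fset_setU ?PoszD //.
- exact: finite_slice.
- exact: finite_slice.
- by move=> v [/AB Av _] [].
Qed.

Lemma cnt_shift A u (k : int) t : A `<=` cone -> L u -> ht u = k%:~R ->
  cnt [set v | A (v - u)] t = cnt A (t - k).
Proof.
move=> AC Lu hu; congr Posz.
rewrite -(@card_fset_set_image _ _ (fun v => v + u) (slice A (t - k))).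
- congr (#|` fset_set _|); apply/seteqP; split=> v /=.
    move=> [Av [Lv hv]]; exists (v - u); last by rewrite subrK.
    split => //; split; first exact: LB.
    by rewrite htB hv hu -intrB.
  move=> [v' [Av [Lv hv]] <-]; split; first by rewrite /= addrK.
  by split; [exact: LD|rewrite htD hv hu -intrD subrK].
- exact: addIr.
- exact: finite_slice.
Qed.

Lemma cnt_reflect A u (k : int) t : A `<=` cone -> L u -> ht u = k%:~R ->
  cnt [set v | A (u - v)] t = cnt A (k - t).
Proof.
move=> AC Lu hu; congr Posz.
rewrite -(@card_fset_set_image _ _ (fun v => u - v) (slice A (k - t))).
- congr (#|` fset_set _|); apply/seteqP; split=> v /=.
    move=> [Av [Lv hv]]; exists (u - v); last by rewrite subKr.
    split => //; split; first exact: LB.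
    by rewrite htB hv hu -intrB.
  move=> [v' [Av [Lv hv]] <-]; split; first by rewrite /= subKr.
  by split; [exact: LB|rewrite htB hv hu -intrB subKr].
- by move=> v v' /addrI/oppr_inj.
- exact: finite_slice.
Qed.

Lemma cnt_bigcup (K : finType) (p : pred K) (A : K -> set V) t :
  (forall k, p k -> A k `<=` cone) ->
  (forall j k v, p j -> p k -> A j v -> A k v -> j = k) ->
  cnt [set v | exists2 k, p k & A k v] t = \sum_(k | p k) cnt (A k) t.
Proof.
move=> AC dA.
have [|||_ h] := @card_fset_set_bigcup _ K (enum p) (fun k => slice (A k) t).
- exact: enum_uniq.
- by move=> k; rewrite mem_enum => /AC; exact: finite_slice.
- by move=> j k v; rewrite !mem_enum => pj pk [Aj _] [Ak _]; exact: dA Aj Ak.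
transitivity (\sum_(k <- enum p) #|` fset_set (slice (A k) t)|)%N%:Z.
  rewrite -h; congr (#|` fset_set _|)%:Z; apply/seteqP; split=> v /=.
    by move=> [[k pk Ak] ?]; exists k; rewrite ?mem_enum.
  by move=> [k]; rewrite mem_enum => pk [Ak ?]; split => //; exists k.
by rewrite big_enum /= -natz natr_sum; apply: eq_bigr => k _; rewrite natz.
Qed.

Lemma cnt_neq0 A t : cnt A t != 0 ->
  exists v, [/\ A v, L v & ht v = t%:~R].
Proof.
move=> h; apply: contrapT => hn; move: h.
have -> : cnt A t = 0; last by rewrite eqxx.
rewrite /cnt; have -> : slice A t = set0.
  by apply/seteqP; split=> v // [? [? ?]]; apply: hn; exists v.
by rewrite fset_set0 cardfs0.
Qed.

Variables (w : I -> R) (g0 : V).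
Hypothesis gw : generic_weight e o w.
Hypothesis gg0 : nondegenerate e o g0.

Lemma cone_coord_ge0 S v : optimal e o w S -> cone v -> 0 <= coords e S v o.
Proof.
move=> oS [mu mu0 ->]; rewrite coords_comb; last exact: oS.1.1.
by apply: sumr_ge0 => j _; rewrite mulr_ge0 // (optimal_coord_ge0 j gw oS).
Qed.

Lemma cell_cone g S v : optimal e o w S -> cell e o g S v ->
  0 <= coords e S v o -> cone v.
Proof.
move=> oS cS vo; have bS := oS.1.1; exists (coords e S v); last by rewrite comb_coords.
move=> i; have [->//|io] := eqVneq i o.
have [iS|iS] := boolP (i \in S); last by rewrite coords_supported.
by have /orP[/ltW|/andP[/eqP -> _]] := cS i iS io.
Qed.

Lemma coords_subo S v a i : optimal e o w S ->
  coords e S (v - a *: e o) i = coords e S v i - a * (i == o)%:R.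
Proof.
move=> [[bS oS] _]; rewrite coordsD // coordsN // coordsZ //.
by rewrite coords_e.
Qed.

(** The coordinate at [o] is the depth: subtracting [a *: e o] changes no other coordinate, so the
    point stays in its cell, where membership in the cone is nonnegativity at [o]. *)
Lemma cell_coneE g S v a : optimal e o w S -> cell e o g S v ->
  cone (v - a *: e o) <-> a <= coords e S v o.
Proof.
move=> oS cS; rewrite -subr_ge0.
have -> : coords e S v o - a = coords e S (v - a *: e o) o.
  by rewrite coords_subo // eqxx mulr1.
split; first exact: cone_coord_ge0.
apply: (@cell_cone g) => // i iS io.
by rewrite coords_subo // (negPf io) mulr0 subr0; exact: cS.
Qed.

(** Depth is determined by the cone alone, so it depends neither on the cell nor on the
    direction. *)
Lemma depth_unique g g' S S' v : optimal e o w S -> optimal e o w S' ->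
  cell e o g S v -> cell e o g' S' v -> coords e S v o = coords e S' v o.
Proof.
move=> oS oS' cS cS'; apply/eqP; rewrite eq_le; apply/andP; split.
  by apply/(cell_coneE _ oS' cS')/(cell_coneE _ oS cS).
by apply/(cell_coneE _ oS cS)/(cell_coneE _ oS' cS').
Qed.

(* The second condition confines the coordinates along [J] to a half-open unit
   interval, [[0, 1)] or [(0, 1]] according to the sign of the coordinate of [g]. *)
Definition box g S J X : set V :=
  [set v | [/\ cell e o g S v,
    forall i, i \in J -> ~~ lexpos (coords e S g i) (coords e S v i - 1)
    & X (coords e S v o)]].

(** With [J] empty no coordinate is bounded above, so whole cells restricted to depths in [X] are
    united. *)
Definition layer g X : set V :=
  [set v | exists2 S, `[< optimal e o w S >] & box g S finset.set0 X v].

Definition nonneg_set X := forall x, X x -> 0 <= x.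

Lemma box_cone g S J X : optimal e o w S -> nonneg_set X -> box g S J X `<=` cone.
Proof. by move=> oS X0 v [cS _ /X0]; exact: (cell_cone oS cS). Qed.

Lemma layer_cone g X : nonneg_set X -> layer g X `<=` cone.
Proof. by move=> X0 v [S /asboolP oS]; exact: box_cone. Qed.

(** Either coordinate [i] lies in its half-open unit interval, or the point remains in the cell
    after subtracting [e i], which has height [q]. Bounding the coordinate thus multiplies the
    generating function by [1 - z^q]. *)
Lemma box_step g S J X i t : optimal e o w S -> nonneg_set X ->
  i \in S -> i != o -> i \notin J ->
  cnt (box g S (i |: J) X) t = diff q (cnt (box g S J X)) t.
Proof.
move=> oS X0 iS io iJ; have [[bS oS'] _] := oS.
have cE v k : coords e S (v - e i) k = coords e S v k - (k == i)%:R.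
  by rewrite coordsD // coordsN // coords_e.
have h1 : box g S J X = box g S (i |: J) X `|` [set v | box g S J X (v - e i)].
  apply/seteqP; split=> v.
    move=> [cS hJ Xv].
    have [hi|hi] := boolP (lexpos (coords e S g i) (coords e S v i - 1)).
      right; split.
      - move=> k kS ko; rewrite cE; have [->//|ki] := eqVneq k i.
        by rewrite subr0; exact: cS.
      - move=> k kJ; rewrite cE; have [ki|ki] := eqVneq k i.
          by rewrite -ki kJ in iJ.
        by rewrite subr0; exact: hJ.
      - by rewrite cE eq_sym (negPf io) subr0.
    left; split => // k; rewrite !inE => /orP[/eqP -> //|]; exact: hJ.
  move=> [[cS hJ Xv]|[cS hJ Xv]]; split => //.
  - by move=> k kJ; apply: hJ; rewrite !inE kJ orbT.
  - move=> k kS ko; have := cS k kS ko; rewrite cE; have [->|ki] := eqVneq k i.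
      by move=> /lexposD1; rewrite subrK.
    by rewrite subr0.
  - move=> k kJ; have := hJ k kJ; rewrite cE; have [ki|ki] := eqVneq k i.
      by rewrite -ki kJ in iJ.
    by rewrite subr0.
  - by move: Xv; rewrite cE eq_sym (negPf io) subr0.
have bc := box_cone (g := g) (J := J) oS X0.
have bc' := box_cone (g := g) (J := i |: J) oS X0.
rewrite /diff {1}h1 cntU //.
- rewrite (@cnt_shift _ (e i) q%:Z) ?hte // ?addrK //.
- by move=> v bv; rewrite -(subrK (e i) v); apply: coneD (cone_e i); exact: bc.
- move=> v [_ h _] [h' _ _].
  have := h i; rewrite !inE eqxx => /(_ isT) /negP; apply.
  by have := h' i iS io; rewrite cE eqxx.
Qed.

Lemma box_iter g S J X t : optimal e o w S -> nonneg_set X ->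
  J \subset S :\ o ->
  iter #|J| (diff q) (cnt (box g S finset.set0 X)) t = cnt (box g S J X) t.
Proof.
move=> oS X0; move En : #|J| => m; elim: m J t En => [|m IH] J t.
  by move=> /eqP; rewrite cards_eq0 => /eqP ->.
move=> Jm JS; have /card_gt0P[i iJ] : (0 < #|J|)%N by rewrite Jm.
have /andP[io iS] : (i != o) && (i \in S).
  by have := fintype.subsetP JS i iJ; rewrite !inE.
have Jm' : #|J :\ i| = m by move: Jm; rewrite (cardsD1 i) iJ => -[].
have JS' : J :\ i \subset S :\ o.
  by apply: fintype.subset_trans JS; exact: subD1set.
rewrite /= /diff !(IH (J :\ i)) // -[in RHS](finset.setD1K iJ).
by rewrite box_step // !inE eqxx.
Qed.

Lemma layer_cnt g X t : nondegenerate e o g -> nonneg_set X ->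
  cnt (layer g X) t =
  \sum_(S | `[< optimal e o w S >]) cnt (box g S finset.set0 X) t.
Proof.
move=> gg X0; apply: cnt_bigcup.
  by move=> S /asboolP oS; exact: box_cone.
move=> S S' v /asboolP oS /asboolP oS' [cS _ _] [cS' _ _].
by have [_ /(_ S S')] := cell_exists_unique pos_span cone_pointed v gw gg; apply.
Qed.

(** The cells of either direction cover the space and a layer is cut out by depth, which is
    intrinsic. This permits passing from [g] to [- g]. *)
Lemma layer_vector g g' X : nondegenerate e o g -> nondegenerate e o g' ->
  layer g X = layer g' X.
Proof.
wlog suff h : g g' / nondegenerate e o g -> nondegenerate e o g' ->
    layer g X `<=` layer g' X.
  by move=> ? ?; apply/seteqP; split; exact: h.
move=> gg gg' v [S /asboolP oS [cS _ Xv]].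
have [[S' oS' cS'] _] := cell_exists_unique pos_span cone_pointed v gw gg'.
exists S'; first exact/asboolP; split => // [i|]; first by rewrite finset.in_set0.
by rewrite (depth_unique oS' oS cS' cS).
Qed.

(** The coefficients of [B0] for [X = {0}] and of [B1] for [X = (0, 1)]. *)
Definition box_sum g X t : int :=
  \sum_(S | `[< optimal e o w S >]) cnt (box g S (S :\ o) X) t.

Lemma layer_box_sum g X t : nondegenerate e o g -> nonneg_set X ->
  iter n (diff q) (cnt (layer g X)) t = box_sum g X t.
Proof.
move=> gg X0; rewrite (eq_iter_diff _ _ (fun t => layer_cnt t gg X0)).
rewrite iter_diff_sum; apply: eq_bigr => S /asboolP oS.
rewrite -box_iter //; congr (iter _ _ _ _).
have := card_basis oS.1.1; rewrite (cardsD1 o) oS.1.2 => -[] //.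
Qed.

(** With [u] the sum of the box edges plus [k *: e o], the map [v -> u - v] carries each box for
    [- g] to the box for [g]. The depth set must be symmetric about [k / 2]: [k] is [0] for depth
    [0] and [1] for depth in [(0, 1)]. *)
Lemma box_sum_reflect g X (k : nat) t : nondegenerate e o g -> nonneg_set X ->
  (forall x, X (k%:R - x) <-> X x) ->
  box_sum g X ((q * n + k * l)%:Z - t) = box_sum (- g) X t.
Proof.
move=> gg X0 Xk; apply: eq_bigr => S /asboolP oS; have [[bS oS'] _] := oS.
pose u := \sum_(i in S :\ o) e i + k%:R *: e o.
have Lsum (K : Type) (r : seq K) (p : pred K) (F : K -> V) :
    (forall j, L (F j)) -> L (\sum_(j <- r | p j) F j).
  by move=> LF; elim/big_rec : _ => // j x _; exact: LD.
have Lu : L u.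
  apply: LD; first exact: Lsum.
  rewrite scaler_nat; elim: (k) => [|m IH]; first by rewrite mulr0n.
  by rewrite mulrS; exact: LD.
have hu : ht u = (q * n + k * l)%:Z%:~R.
  rewrite htD htZ hto ht_sum (eq_bigr (fun=> q%:R)); last first.
    by move=> i; rewrite !inE => /andP[? _]; exact: hte.
  have -> : n = #|S :\ o|.
    by have := card_basis bS; rewrite (cardsD1 o) oS' add1n => -[->].
  by rewrite sumr_const PoszD intrD -!pmulrn mulrnA natrM.
have cE v i : i \in S -> coords e S (u - v) i =
    (if i == o then k%:R else 1) - coords e S v i.
  move=> iS; rewrite coordsD // coordsN // coordsD // coordsZ // coords_sum //.
  rewrite coords_e //; congr (_ - _); have [->|io] := eqVneq i o.
    rewrite big1 ?add0r ?mulr1 // => j; rewrite !inE => /andP[jo jS].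
    by rewrite coords_e // eq_sym (negPf jo).
  rewrite mulr0 addr0 (bigD1 i) ?inE ?io //= coords_e // eqxx big1 ?addr0 //.
  move=> j; rewrite !inE => /andP[/andP[jo jS] ji].
  by rewrite coords_e // eq_sym (negPf ji).
have bc := box_cone (g := g) (J := S :\ o) oS X0.
rewrite -(cnt_reflect t bc Lu hu); congr cnt; apply/seteqP; split=> v /=.
  move=> [cS hJ Xv]; split.
  - move=> i iS io; have := hJ i; rewrite !inE io iS cE // (negPf io).
    move=> /(_ isT); rewrite coordsN //.
    have -> : 1 - coords e S v i - 1 = - coords e S v i by ring.
    by rewrite lexposN ?gg // negbK.
  - move=> i; rewrite !inE => /andP[io iS]; have := cS i iS io.
    rewrite cE // (negPf io) coordsN // -opprB lexposN ?gg //.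
  - by move: Xv; rewrite cE // eqxx Xk.
move=> [cS hJ Xv]; split.
- move=> i iS io; have := hJ i; rewrite !inE io iS cE // (negPf io).
  by move=> /(_ isT); rewrite coordsN // -[1 - _]opprB lexposN ?gg.
- move=> i; rewrite !inE => /andP[io iS]; have := cS i iS io.
  rewrite cE // (negPf io) coordsN //.
  have -> : 1 - coords e S v i - 1 = - coords e S v i by ring.
  by rewrite lexposN ?gg // negbK.
- by rewrite cE // eqxx Xk.
Qed.

Lemma box_sum_ge0 g X t : 0 <= box_sum g X t.
Proof. by apply: sumr_ge0 => S _. Qed.

(** The box sums for [g] and [- g] agree, both being the [n]-th difference of the same layer
    count. *)
Lemma box_sum_palindrome X (k : nat) t : nonneg_set X ->
  (forall x, X (k%:R - x) <-> X x) ->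
  box_sum g0 X ((q * n + k * l)%:Z - t) = box_sum g0 X t.
Proof.
move=> X0 Xk; rewrite box_sum_reflect //.
rewrite -!layer_box_sum ?(layer_vector X gg0 (nondegenerateN gg0)) //.
exact: nondegenerateN.
Qed.

Lemma box_sum_neq0 g X t : nonneg_set X -> box_sum g X t != 0 ->
  exists v S, [/\ optimal e o w S, cell e o g S v, X (coords e S v o), L v
    & ht v = t%:~R].
Proof.
move=> X0 h; apply: contrapT => hn; move: h; rewrite /box_sum big1 ?eqxx // => S.
move=> /asboolP oS; apply/eqP/negPn/negP => /cnt_neq0[v [[cS _ Xv] Lv hv]].
by apply: hn; exists v, S.
Qed.

Lemma cone_cnt_split t : cnt cone t - cnt cone (t - l%:Z) =
  cnt (layer g0 [set 0]) t + cnt (layer g0 [set x | 0 < x < 1]) t.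
Proof.
have X0 : nonneg_set [set 0] by move=> x /= ->.
have X1 : nonneg_set [set x | 0 < x < 1] by move=> x /= /andP[/ltW].
have [c0 c1] := (layer_cone (g := g0) X0, layer_cone (g := g0) X1).
have c01 : layer g0 [set 0] `|` layer g0 [set x | 0 < x < 1] `<=` cone.
  by move=> v [/c0|/c1].
have split_cone : cone = (layer g0 [set 0] `|` layer g0 [set x | 0 < x < 1])
    `|` [set v | cone (v - e o)].
  apply/seteqP; split=> v.
    move=> cv.
    have [[S oS cS] _] := cell_exists_unique pos_span cone_pointed v gw gg0.
    have := cone_coord_ge0 oS cv; rewrite le_eqVlt => /orP[/eqP vo|vo].
      left; left; exists S; first exact/asboolP.
      by split => // i; rewrite finset.in_set0.
    have [v1|v1] := ltP (coords e S v o) 1.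
      left; right; exists S; first exact/asboolP.
      by split => //= [i|]; rewrite ?finset.in_set0 // vo.
    by right; have := (cell_coneE 1 oS cS).2 v1; rewrite scale1r.
  by move=> [/c01 //|h]; rewrite -(subrK (e o) v); apply: coneD (cone_e o).
rewrite {1}split_cone cntU //.
- rewrite (cntU _ c0 c1); last first.
    move=> v [S /asboolP oS [cS _ /= Sv]] [S' /asboolP oS' [cS' _ /=]].
    by rewrite -(depth_unique oS oS' cS cS') Sv ltxx.
  by rewrite (@cnt_shift _ (e o) l%:Z) ?addrK.
- by move=> v h; rewrite -(subrK (e o) v); apply: coneD (cone_e o).
- move=> v h1 h2.
  have [S oS [cS v1]] : exists2 S, optimal e o w S &
      cell e o g0 S v /\ coords e S v o < 1.
    case: h1 => -[S /asboolP oS [cS _ /=]].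
      by move=> Sv; exists S => //; rewrite Sv ltr01.
    by move=> /andP[_ ?]; exists S.
  have := cell_coneE 1 oS cS; rewrite scale1r => -[/(_ h2)].
  by rewrite leNgt v1.
Qed.

End Counting.

(** The interface between geometry and algebra: [N0] and [N1] count the two layers, and [B0], [B1]
    are their numerators. The last clause ties the support of [B1] to lattice points of positive
    depth, which will bound it below by [l]. *)
Theorem cone_count_decomposition (R : realFieldType) (V : lmodType R)
    (I : finType) (e : I -> V) (o : I) (L : set V) (ht : V -> R)
    (q l n : nat) :
  (forall i, L (e i)) -> L 0 -> (forall u v, L u -> L v -> L (u - v)) ->
  (forall a u v, ht (a *: u + v) = a * ht u + ht v) ->
  (forall i, i != o -> ht (e i) = q%:R) -> ht (e o) = l%:R ->
  (0 < q)%N -> (0 < l)%N ->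
  (forall v, exists2 mu, (forall i, i != o -> 0 <= mu i) & v = comb e mu) ->
  (forall t : int, finite_set [set v | [/\ cone e v, L v & ht v = t%:~R]]) ->
  (forall S, is_basis e S -> #|S| = n.+1) ->
  exists N0 N1 B0 B1 : int -> int,
    [/\ (forall t, cnt L ht (cone e) t - cnt L ht (cone e) (t - l%:Z) =
           N0 t + N1 t),
        iter n (diff q) N0 =1 B0, iter n (diff q) N1 =1 B1
      & [/\ forall t, 0 <= B0 t, forall t, 0 <= B1 t,
            forall t, B0 ((q * n)%:Z - t) = B0 t,
            forall t, B1 ((q * n + l)%:Z - t) = B1 t
          & (forall t, t < 0 -> B0 t = 0) /\
            forall t, B1 t != 0 -> exists v, [/\ L v, ht v = t%:~R
              & exists2 a, 0 < a & cone e (v - a *: e o)]]].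
Proof.
move=> Le L0 LB htP hte hto q0 l0 pos_span fin card.
have pt := cone_pointed htP hte hto q0 l0.
have [w gw] := exists_generic_weight o pt.
have [g gg] := exists_nondegenerate e o.
have X0 : nonneg_set [set (0 : R)] by move=> x /= ->.
have X1 : nonneg_set [set x : R | 0 < x < 1] by move=> x /= /andP[/ltW].
exists (cnt L ht (layer e o w g [set 0])), (cnt L ht (layer e o w g [set x | 0 < x < 1])),
  (box_sum e o L ht w g [set 0]), (box_sum e o L ht w g [set x | 0 < x < 1]).
split.
- by move=> t; apply: (cone_cnt_split Le L0 LB htP hte hto q0 l0 pos_span fin gw gg).
- by move=> t; apply: (layer_box_sum Le L0 LB htP hte hto q0 l0 pos_span fin card gw).
- by move=> t; apply: (layer_box_sum Le L0 LB htP hte hto q0 l0 pos_span fin card gw).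
split.
- by move=> t; exact: box_sum_ge0.
- by move=> t; exact: box_sum_ge0.
- move=> t; rewrite -[(q * n)%N]addn0 -(mul0n l).
  apply: (box_sum_palindrome Le L0 LB htP hte hto q0 l0 pos_span fin card gw gg) => //.
  by move=> x /=; rewrite sub0r; split => [/eqP|->]; rewrite ?oppr_eq0 ?oppr0 // => /eqP.
- move=> t; rewrite -{1}(mul1n l).
  apply: (box_sum_palindrome Le L0 LB htP hte hto q0 l0 pos_span fin card gw gg) => //.
  by move=> x /=; split => /andP[h1 h2]; apply/andP; split; lra.
split=> t.
  move=> t0; apply/eqP/negPn/negP => /(box_sum_neq0 X0)[v [S [oS cS Xv Lv hv]]].
  have : cone e v by apply: (cell_cone oS cS); rewrite Xv.
  by move=> /(cone_ht_ge0 htP hte hto q0 l0); rewrite hv ler0z leNgt t0.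
move=> /(box_sum_neq0 X1)[v [S [oS cS /andP[v0 v1] Lv hv]]]; exists v; split => //.
(* The depth of [v] is the required multiple. *)
by exists (coords e S v o) => //; apply/(cell_coneE gw _ oS cS).
Qed.

(** * Coefficient sequences *)

Lemma series_mulE (f : nat -> int) (p : {poly int}) (N n : nat) : (n < N)%N ->
  series_mul f (poly_series p) n = (\poly_(i < N) f i * p)`_n.
Proof.
move=> nN; rewrite coefM; apply: eq_bigr => i _; rewrite coef_poly.
by rewrite (leq_trans (ltn_ord i)).
Qed.

Lemma series_mul_1subXn (f : nat -> int) (p : {poly int}) q n :
  series_mul f (poly_series (p * (1 - 'X^q))) n =
  series_mul f (poly_series p) n -
  (if (n < q)%N then 0 else series_mul f (poly_series p) (n - q)%N).
Proof.
rewrite !(@series_mulE f _ n.+1) ?ltnS ?leq_subr //.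
by rewrite mulrA mulrBr mulr1 coefB coefMXn.
Qed.

Lemma iter_diff_lt0 q k (F : int -> int) t : (forall t, t < 0 -> F t = 0) ->
  t < 0 -> iter k (diff q) F t = 0.
Proof.
move=> F0; elim: k t => [|k IH] t t0 /=; first exact: F0.
by rewrite /diff !IH ?subrr //; lia.
Qed.

(** Extending [f] by [0] to negative indices absorbs the truncation of the convolution at index
    [0]. *)
Lemma series_mul_iter_diff (f : nat -> int) (F : int -> int) q k n :
  (forall n : nat, F n%:Z = f n) -> (forall t, t < 0 -> F t = 0) ->
  series_mul f (poly_series ((1 - 'X^q) ^+ k)) n = iter k (diff q) F n%:Z.
Proof.
move=> Ff F0; elim: k n => [|k IH] n.
  rewrite (@series_mulE f _ n.+1) // expr0 mulr1 coef_poly ltnSn.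
  by rewrite -Ff.
rewrite exprSr series_mul_1subXn IH /= /diff; congr (_ - _).
case: ltnP => nq; last by rewrite IH subzn.
by rewrite iter_diff_lt0 //; lia.
Qed.

Lemma iter_diff_comm q l k f t :
  iter k (diff q) (diff l f) t = diff l (iter k (diff q) f) t.
Proof.
elim: k t => //= k IH t; rewrite /diff !IH /diff.
by rewrite [t - q%:Z - l%:Z]addrAC; ring.
Qed.

Lemma iter_diffD q k f g t : iter k (diff q) (fun t => f t + g t) t =
  iter k (diff q) f t + iter k (diff q) g t.
Proof. by elim: k t => //= k IH t; rewrite /diff !IH; ring. Qed.

(** Division by [1 - z] made explicit: as [f] vanishes before [c], the shifted sum is the other one
    without its last [q] terms, or empty when [n <= q]. *)
Lemma sum_shift_le (f : int -> int) (c : int) (q n : nat) :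
  (forall t, 0 <= f t) -> (forall t, t < c -> f t = 0) ->
  \sum_(j < n) f (c + j%:Z - q%:Z) <= \sum_(j < n) f (c + j%:Z).
Proof.
move=> f0 fc.
have -> : \sum_(j < n) f (c + j%:Z - q%:Z) = \sum_(j < (n - q)%N) f (c + j%:Z).
  elim: n => [|n IH]; first by rewrite sub0n !big_ord0.
  rewrite big_ord_recr /= IH; have [nq|nq] := ltnP n q.
    have -> : (n.+1 - q = n - q)%N by lia.
    by rewrite fc ?addr0 //; lia.
  rewrite subSn // big_ord_recr /=; congr (_ + f _); lia.
rewrite -[X in _ <= X](big_mkord xpredT (fun j => f (c + j%:Z))).
rewrite (@big_cat_nat _ _ _ (n - q)%N) ?leq_subr //= big_mkord lerDl.
exact: sumr_ge0.
Qed.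

(** * From the symmetries of the numerators to the inequalities *)

Section Inequalities.
Variables (q d l : nat) (H B0 B1 : int -> int).
Let m : int := (q * d.+1)%:Z.
Hypothesis l_gt0 : (0 < l)%N.
Hypothesis H_lt0 : forall t, t < 0 -> H t = 0.
Hypothesis H_ge : forall t, m <= t -> H t = 0.
Hypothesis HE : forall t, diff l H t = diff q B0 t + diff q B1 t.
Hypothesis B0_sym : forall t, B0 ((q * d)%:Z - t) = B0 t.
Hypothesis B1_sym : forall t, B1 ((q * d + l)%:Z - t) = B1 t.
Hypothesis B0_lt0 : forall t, t < 0 -> B0 t = 0.

(** The defect [X] is [l]-periodic and vanishes at negative arguments, hence everywhere. For
    periodicity, add [HE] at [s] and at [m - s + l]; by the palindromes the [B1] terms cancel. *)
Lemma hstar_boundary t : H t - H (m - t) = diff q B0 t.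
Proof.
pose X t := H t - H (m - t) - diff q B0 t.
have mE : m = (q * d)%:Z + q%:Z by rewrite /m mulnS addnC.
have Xl s : X s = X (s - l%:Z).
  have h1 := HE s; have h2 := HE (m - s + l%:Z).
  have e1 : B0 (m - s + l%:Z) = B0 (s - l%:Z - q%:Z).
    by rewrite -(B0_sym (s - l%:Z - q%:Z)); congr B0; lia.
  have e2 : B0 (m - s + l%:Z - q%:Z) = B0 (s - l%:Z).
    by rewrite -(B0_sym (s - l%:Z)); congr B0; lia.
  have e3 : B1 (m - s + l%:Z) = B1 (s - q%:Z).
    by rewrite -(B1_sym (s - q%:Z)); congr B1; lia.
  have e4 : B1 (m - s + l%:Z - q%:Z) = B1 s.
    by rewrite -(B1_sym s); congr B1; lia.
  have e5 : m - (s - l%:Z) = m - s + l%:Z by ring.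
  have e6 : m - s + l%:Z - l%:Z = m - s by ring.
  by move: h1 h2; rewrite /X /diff e1 e2 e3 e4 e5 e6; lia.
have Xn s : s < 0 -> X s = 0.
  move=> s0; rewrite /X /diff H_lt0 // H_ge ?B0_lt0 //; lia.
have Xk k s : X s = X (s - (k * l)%:Z).
  elim: k s => [|k IH] s; first by rewrite mul0n subr0.
  by rewrite IH Xl; congr X; rewrite mulSn; lia.
(* As [l] is positive, [|t| + 1] periods lead to a negative argument. *)
have : X t = 0 by rewrite (Xk `|t|%N.+1) Xn // mulSn; nia.
by rewrite /X => /eqP; rewrite subr_eq0 => /eqP.
Qed.

Lemma hstar_interior t : H (m - t) - H (t - l%:Z) = diff q B1 t.
Proof. by have := HE t; have := hstar_boundary t; rewrite {2}/diff; lra. Qed.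

Hypothesis B0_ge0 : forall t, 0 <= B0 t.

Lemma hstar_lower (i : nat) :
  \sum_(j < i.+1) H (m - 1 - j%:Z) <= \sum_(j < i.+2) H j%:Z.
Proof.
(* Prepending [H m], which is [0], gives both sums [i + 2] terms to be compared index by index. *)
have -> : \sum_(j < i.+1) H (m - 1 - j%:Z) = \sum_(j < i.+2) H (m - j%:Z).
  rewrite [RHS]big_ord_recl subr0 H_ge // add0r; apply: eq_bigr => j _.
  by congr H; rewrite /= /bump; lia.
rewrite -subr_ge0 -sumrB; under eq_bigr do rewrite hstar_boundary.
rewrite /diff sumrB subr_ge0.
have := @sum_shift_le B0 0 q i.+2 B0_ge0 B0_lt0.
by under eq_bigr do rewrite add0r; under [X in _ <= X]eq_bigr do rewrite add0r.
Qed.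

Hypothesis B1_ge0 : forall t, 0 <= B1 t.
Hypothesis B1_lt : forall t, t < l%:Z -> B1 t = 0.

Lemma hstar_upper (i : nat) :
  \sum_(j < i.+1) H j%:Z <= \sum_(j < i.+1) H (m - l%:Z - j%:Z).
Proof.
rewrite -subr_ge0 -sumrB.
(* The interior identity is used from [l] on, the first place where [B1] can be nonzero. *)
rewrite (eq_bigr (fun j : 'I_i.+1 => diff q B1 (l%:Z + j%:Z))); last first.
  move=> j _; rewrite -hstar_interior; congr (H _ - H _); ring.
by rewrite /diff sumrB subr_ge0; exact: sum_shift_le.
Qed.

Hypothesis q_gt0 : (0 < q)%N.
Hypothesis H0 : H 0 = 1.

(** At [l] the interior identity reads [H (m - l) = 1 + B1 l]; above [m - l] every other term in it
    vanishes. So the degree is [m - l]. *)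
Lemma hstar_codegree : H (m - l%:Z) > 0 /\ forall t, m - l%:Z < t -> H t = 0.
Proof.
split.
  have := hstar_interior l%:Z; rewrite subrr H0 /diff (B1_lt (t := _ - _)); last lia.
  by have := B1_ge0 l%:Z; lia.
move=> t mt; have := hstar_interior (m - t); rewrite /diff subKr.
rewrite (H_lt0 (t := _ - l%:Z)) ?(B1_lt (t := m - t)) ?(B1_lt (t := _ - q%:Z)); lia.
Qed.

End Inequalities.

(** * Vertices of a polytope *)

Section Vertices.
Variables (R : realType) (d N : nat) (p : 'I_N -> 'rV[R]_d).
Implicit Types (T : {set 'I_N}) (w : 'I_N -> R) (x y : 'rV[R]_d).

Definition hull_on T : set 'rV[R]_d :=
  [set x | exists w, [/\ forall i, 0 <= w i, supported T w, \sum_i w i = 1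
                       & x = comb p w]].

Lemma hull_on_range x : convex_hull (range p) x <-> hull_on [set: 'I_N]%SET x.
Proof.
split=> [[n [p' [w [Ap w0 w1 ->]]]]|[w [w0 _ w1 ->]]]; last first.
  by exists N, p, w; split => // i; exists i.
have /choice[f hf] : forall i, exists j, p j = p' i.
  by move=> i; have [j _ <-] := Ap i; exists j.
exists (fun j => \sum_(i | f i == j) w i); split.
- by move=> j; exact: sumr_ge0.
- by move=> j; rewrite finset.in_setT.
- by rewrite -[RHS]w1 (partition_big f xpredT).
- rewrite (partition_big f xpredT) //=; apply: eq_bigr => j _.
  rewrite scaler_suml; apply: eq_bigr => i /eqP <-.
  by rewrite hf.
Qed.

Lemma hull_on_point T i : i \in T -> hull_on T (p i).
Proof.
move=> iT; exists (fun j => (j == i)%:R); split => //.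
- by move=> j; exact: supported1.
- by rewrite (bigD1 i) //= eqxx big1 ?addr0 // => j /negPf ->.
- by rewrite comb1.
Qed.

Lemma hull_on_remove T i w : (forall j, 0 <= w j) -> supported T w ->
  \sum_j w j = 1 -> w i < 1 ->
  exists2 y, hull_on (T :\ i) y & comb p w = w i *: p i + (1 - w i) *: y.
Proof.
move=> w0 sw w1 wi; have wi' : 1 - w i != 0 by rewrite subr_eq0 gt_eqF.
(* The weights with entry [i] deleted, rescaled to sum [1]; the final [+ 0] fits the shape of
   [combD]. *)
pose c j := (1 - w i)^-1 * (- w i * (j == i)%:R + w j) + 0.
have cE : comb p c = (1 - w i)^-1 *: (- w i *: p i + comb p w).
  rewrite combD combD comb1 [X in _ + X]/comb [X in _ + X]big1 ?addr0 // => j _.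
  exact: scale0r.
exists (comb p c).
  exists c; split => //.
  - move=> j; rewrite /c addr0 mulr_ge0 ?invr_ge0 ?subr_ge0 ?(ltW wi) //.
    by have [->|_] := eqVneq j i; rewrite ?mulr1 ?addNr // mulr0 add0r.
  - move=> j; rewrite !inE negb_and negbK => /orP[/eqP ->|jT].
      by rewrite /c eqxx mulr1 addNr mulr0 addr0.
    rewrite /c (sw _ jT) !addr0; have [ji|_] := eqVneq j i; last by rewrite !mulr0.
    by rewrite -ji (sw _ jT) oppr0 mul0r mulr0.
  - rewrite /c; under eq_bigr do rewrite addr0.
    rewrite -mulr_sumr big_split /= w1 -mulr_sumr (bigD1 i) //= eqxx big1.
      by rewrite addr0 mulr1 addrC mulVf.
    by move=> j /negPf ->.
by rewrite cE scalerA divff // scale1r addrA scaleNr subrr add0r.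
Qed.

Lemma hull_on_convex T x y t : 0 <= t <= 1 -> hull_on T x -> hull_on T y ->
  hull_on T ((1 - t) *: x + t *: y).
Proof.
move=> /andP[t0 t1] [a [a0 sa a1 ->]] [b [b0 sb b1 ->]].
exists (fun i => (1 - t) * a i + (t * b i + 0)); split.
- by move=> i; rewrite addr0 addr_ge0 // mulr_ge0 // subr_ge0.
- by move=> i iT; rewrite sa // sb // !mulr0 !addr0.
- under eq_bigr do rewrite addr0; rewrite big_split /= -!mulr_sumr a1 b1; ring.
- rewrite combD combD [X in _ = _ + (_ + X)]/comb [X in _ = _ + (_ + X)]big1 ?addr0 //.
  by move=> i _; exact: scale0r.
Qed.

Lemma weight_le1 w i : (forall j, 0 <= w j) -> \sum_j w j = 1 -> w i <= 1.
Proof.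
move=> w0 <-; rewrite (bigD1 i) //= lerDl; exact: sumr_ge0.
Qed.

Lemma comb_weight1 w i : (forall j, 0 <= w j) -> \sum_j w j = 1 -> w i = 1 ->
  comb p w = p i.
Proof.
move=> w0 w1 wi; rewrite -comb1; congr comb; apply: funext => j.
have [->//|ji] := eqVneq j i.
apply/eqP; rewrite eq_le w0 andbT; move: w1; rewrite (bigD1 i) //= (bigD1 j) //=.
have : 0 <= \sum_(k | (k != i) && (k != j)) w k by exact: sumr_ge0.
by move: wi; rewrite /=; lra.
Qed.

Lemma hull_on_irredundant T i : i \in T -> hull_on (T :\ i) (p i) ->
  hull_on T `<=` hull_on (T :\ i).
Proof.
move=> iT hi x [w [w0 sw w1 ->]]; have [wi|wi] := ltP (w i) 1.
  have [y hy ->] := hull_on_remove w0 sw w1 wi.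
  by rewrite addrC; apply: hull_on_convex => //; rewrite w0 ltW.
suff -> : comb p w = p i by [].
by apply: comb_weight1 => //; apply/eqP; rewrite eq_le wi weight_le1.
Qed.

(** Choose [i] of positive weight. A weight [1] gives [p i] itself; otherwise the vertex lies
    strictly between [p i] and a hull point, and extremality identifies all three. *)
Lemma vertices_range : vertices (hull_on [set: 'I_N]%SET) `<=` range p.
Proof.
move=> v [[w [w0 sw w1 vE]] ext].
have [i wi] : exists i, 0 < w i.
  apply: contrapT => hn; move: w1; rewrite big1 => [/eqP|i _].
    by rewrite eq_sym oner_eq0.
  by apply/eqP; rewrite eq_le w0 andbT leNgt; apply/negP => ?; apply: hn; exists i.
exists i => //; have := weight_le1 i w0 w1; rewrite le_eqVlt => /orP[/eqP wi1|wi1].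
  by rewrite vE (comb_weight1 w0 w1 wi1).
have [y [c [c0 _ c1 yE]] hy] := hull_on_remove w0 sw w1 wi1.
have [||||//] := ext y (p i) (w i).
- by exists c; split => // j; rewrite finset.in_setT.
- by apply: hull_on_point; rewrite finset.in_setT.
- by rewrite wi.
- by rewrite vE hy addrC.
Qed.

(** Suppose [p i] is interior to a segment and mix the weights of its ends. A mixed weight below [1]
    at [i] would express [p i] by the other points; a mixed weight [1] forces weight [1] at both
    ends. *)
Lemma minimal_vertices T : (forall i, i \in T -> ~ hull_on (T :\ i) (p i)) ->
  forall i, i \in T -> vertices (hull_on T) (p i).
Proof.
move=> Tmin i iT; split; first exact: hull_on_point.
move=> x y t [a [a0 sa a1 ->]] [b [b0 sb b1 ->]] /andP[t0 t1] hi.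
pose c j := (1 - t) * a j + (t * b j + 0).
have c0 j : 0 <= c j.
  by rewrite /c addr0 addr_ge0 // mulr_ge0 // ?subr_ge0 ltW.
have sc : supported T c by move=> j jT; rewrite /c sa // sb // !mulr0 !addr0.
have c1 : \sum_j c j = 1.
  rewrite /c; under eq_bigr do rewrite addr0.
  by rewrite big_split /= -!mulr_sumr a1 b1; ring.
have cE : comb p c = p i.
  rewrite combD combD hi [X in _ + (_ + X) = _]/comb [X in _ + (_ + X) = _]big1 ?addr0 //.
  by move=> j _; exact: scale0r.
have ci : c i = 1.
  apply/eqP; rewrite eq_le weight_le1 //= leNgt; apply/negP => ci.
  have [z hz] := hull_on_remove c0 sc c1 ci; rewrite cE => zE.
  apply: (Tmin i iT); suff <- : z = p i by [].
  have ci' : 1 - c i != 0 by rewrite subr_eq0 gt_eqF.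
  apply: (scalerI ci'); apply: (addrI (c i *: p i)); rewrite -zE.
  by rewrite -scalerDl addrCA subrr addr0 scale1r.
have ai := weight_le1 i a0 a1; have bi := weight_le1 i b0 b1.
by split; apply: comb_weight1 => //; move: ci; rewrite /c; nra.
Qed.

Lemma minimal_hull : exists2 T, hull_on T = hull_on [set: 'I_N]%SET &
  forall i, i \in T -> ~ hull_on (T :\ i) (p i).
Proof.
pose Q T := `[< hull_on T = hull_on [set: 'I_N]%SET >].
have Q0 : Q [set: 'I_N]%SET by apply/asboolP.
have [T /asboolP TE Tmin] := @arg_minnP _ _ Q (fun T : {set 'I_N} => #|T|) Q0.
exists T => // i iT hi.
have : (#|T| <= #|T :\ i|)%N.
  apply: Tmin; apply/asboolP; rewrite -TE; apply/seteqP; split.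
    move=> x [w [w0 sw w1 ->]]; exists w; split => // j jT; apply: sw.
    by rewrite !inE (negPf jT) andbF.
  exact: hull_on_irredundant.
by rewrite [X in (X <= _)%N](cardsD1 i) iT ltnn.
Qed.

End Vertices.

(** A smallest subfamily of the given points with the same hull consists of vertices. Finiteness of
    the vertex set makes [denominator] an honest lcm. *)
Lemma polytope_vertices (R : realType) (d : nat) (P : set 'rV[R]_d) :
  polytope P -> finite_set (vertices P) /\
  exists n (v : 'I_n -> 'rV[R]_d), (forall i, vertices P (v i)) /\
    forall x, P x <-> exists w : 'I_n -> R,
      [/\ forall i, 0 <= w i, \sum_i w i = 1 & x = \sum_i w i *: v i].
Proof.
move=> [A fA PE]; have [s As] := (finite_seqP A).1 fA.
pose p (i : 'I_(size s)) := s`_i.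
have AE : A = range p.
  rewrite As; apply/seteqP; split=> y /= => [ys|[i _ <-]]; last exact: mem_nth.
  have hi : (index y s < size s)%N by rewrite index_mem.
  by exists (Ordinal hi) => //; rewrite /p /= nth_index.
have {}PE : P = hull_on p [set: 'I_(size s)]%SET.
  by rewrite PE AE; apply/seteqP; split=> x /hull_on_range.
split.
  rewrite PE; apply: sub_finite_set (@vertices_range _ _ _ p) _.
  exact: finite_image.
have [T TE Tmin] := minimal_hull p.
exists #|T|, (fun k => p (enum_val k)); split.
  by move=> k; rewrite PE -TE; apply: minimal_vertices => //; exact: enum_valP.
move=> x; rewrite PE -TE; split=> [[w [w0 sw w1 ->]]|[w [w0 w1 ->]]].
  exists (fun k => w (enum_val k)); split => //.
    rewrite -(big_enum_val (A := mem T) (fun i => w i)) /= -[RHS]w1 [LHS]big_mkcond /=.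
    by apply: eq_bigr => i _; case: ifPn => // /sw.
  rewrite -(big_enum_val (A := mem T) (fun i => w i *: p i)) /= [RHS]big_mkcond /=.
  by apply: eq_bigr => i _; case: ifPn => // /sw ->; rewrite scale0r.
pose c i := \sum_(k | enum_val k == i) w k.
exists c; split.
- by move=> i; exact: sumr_ge0.
- move=> i iT; apply: big1 => k /eqP ki.
  by move: iT; rewrite -ki enum_valP.
- by rewrite -[RHS]w1 [RHS](partition_big (fun k => enum_val k) xpredT).
- rewrite (partition_big (fun k => enum_val k) xpredT) //=; apply: eq_bigr => i _.
  by rewrite scaler_suml; apply: eq_bigr => k /eqP ->.
Qed.

(** * The cone over a rational polytope *)

Lemma real_denom_gt0 (R : realType) (x : R) : (0 < real_denom x)%N.
Proof. by rewrite /real_denom absz_gt0 denq_eq0. Qed.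

Lemma real_denom_int (R : realType) (x : R) (r : rat) : x = ratr r ->
  (real_denom x)%:R * x \is a Num.int.
Proof.
move=> xr; rewrite /real_denom.
have /(_ (ex_intro _ r _))/= := @xgetPex _ (0 : rat) [set r | ratr r = x].
set r' := xget _ _ => /(_ (esym xr)) xr'.
have numE : ratr r' * (denq r')%:~R = (numq r')%:~R :> R.
  by rewrite -(ratr_int R (denq r')) -(ratr_int R (numq r')) -rmorphM -numqE.
apply/Num.Theory.intrP; exists (numq r'); rewrite -numE xr' mulrC.
by rewrite pmulrn gez0_abs // denq_ge0.
Qed.

Lemma denominator_gt0 (R : realType) (d : nat) (P : set 'rV[R]_d) :
  (0 < denominator P)%N.
Proof.
rewrite /denominator; elim/big_rec : _ => // v m _ m0; rewrite lcmn_gt0 m0 andbT.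
by elim/big_rec : _ => // i k _ k0; rewrite lcmn_gt0 real_denom_gt0 k0.
Qed.

Lemma denominator_dvd (R : realType) (d : nat) (P : set 'rV[R]_d) v i :
  finite_set (vertices P) -> vertices P v ->
  (real_denom (v 0%R i) %| denominator P)%N.
Proof.
move=> fV Vv; rewrite /denominator fsbig_finite //=.
have vf : v \in fset_set (vertices P) by rewrite in_fset_set // mem_set.
rewrite (bigD1_seq v) ?fset_uniq //=; apply: dvdn_trans (dvdn_lcml _ _).
exact: (biglcmn_sup i).
Qed.

Lemma finite_int_box (R : realType) (n : nat) (K : R) :
  finite_set [set x : 'rV[R]_n | forall i, x 0 i \is a Num.int /\ `|x 0 i| <= K].
Proof.
have [k Kk] : exists k : nat, K <= k%:R.
  exists (Num.bound `|K|); apply: le_trans (ler_norm K) _.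
  by apply/ltW/archi_boundP.
pose f (phi : {ffun 'I_n -> 'I_(k + k).+1}) : 'rV[R]_n :=
  \row_i ((phi i)%:R - k%:R).
apply: (@sub_finite_set _ _ (f @` setT)); last exact/finite_image/finite_finset.
move=> x hx.
have /choice[m hm] : forall i, exists m : int, x 0 i = m%:~R.
  by move=> i; have [/Num.Theory.intrP[m ->] _] := hx i; exists m.
exists [ffun i => inord `|m i + k%:Z|] => //; apply/rowP => i.
rewrite mxE ffunE; have [_] := hx i; rewrite hm => /le_trans/(_ Kk).
rewrite -intr_norm -[k%:R]/(k%:Z%:~R) ler_int => mk.
rewrite inordK; last by lia.
by rewrite pmulrn gez0_abs ?intrD ?addrK //; lia.
Qed.

(** The matrix with the members of [S] as rows has full row rank and full column rank, so it is
    square. *)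
Lemma card_is_basis (R : realFieldType) (n : nat) (I : finType)
    (e : I -> 'rV[R]_n) (S : {set I}) : is_basis e S -> #|S| = n.
Proof.
move=> [sp ind]; pose M := \matrix_(k < #|S|) e (enum_val k).
have ME (u : 'rV_#|S|) : u *m M = \sum_k u 0 k *: e (enum_val k).
  by rewrite mulmx_sum_row; apply: eq_bigr => k _; rewrite rowK.
have free : row_free M.
  rewrite -kermx_eq0; apply/eqP/row_matrixP => r; rewrite row0.
  set u := row r _; have uM : u *m M = 0.
    by apply/eqP; rewrite -sub_kermx row_sub.
  pose mu i := \sum_(k | enum_val k == i) u 0 k.
  have mu0 : forall i, mu i = 0.
    apply: ind.
      by move=> i iS; apply: big1 => k /eqP ki; move: iS; rewrite -ki enum_valP.
    rewrite -[RHS]uM ME (partition_big (fun k => enum_val k) xpredT) //=.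
    by apply: eq_bigr => i _; rewrite scaler_suml; apply: eq_bigr => k /eqP ->.
  apply/rowP => k; rewrite [RHS]mxE -[RHS](mu0 (enum_val k)) /mu.
  rewrite (bigD1 k) //= big1 ?addr0 // => j /andP[/eqP/enum_val_inj ->].
  by rewrite eqxx.
have full : row_full M.
  rewrite -sub1mx; apply/row_subP => r; have [mu smu ->] := sp (row r 1%:M).
  apply/submxP; exists (\row_k mu (enum_val k)); rewrite ME.
  under [RHS]eq_bigr do rewrite mxE.
  rewrite -(big_enum_val (A := mem S) (fun i => mu i *: e i)) /= [RHS]big_mkcond /=.
  by apply: eq_bigr => i _; case: ifPn => // /smu ->; rewrite scale0r.
by rewrite -(eqP (free : \rank M == #|S|)); exact: eqP (full : \rank M == n).
Qed.

(** * Homogenisation: adding a height coordinate *)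

Section Lift.
Variables (R : realType) (d : nat).
Implicit Types (x y : 'rV[R]_d) (z : 'rV[R]_(d + 1)).

Definition homog x (c : R) : 'rV[R]_(d + 1) := row_mx x c%:M.
Definition height z : R := z 0 (rshift d ord0).

Lemma height_homog x c : height (homog x c) = c.
Proof. by rewrite /height row_mxEr mxE eqxx. Qed.

Lemma homogK x c : lsubmx (homog x c) = x.
Proof. exact: row_mxKl. Qed.

Lemma homog_lsubmx z : homog (lsubmx z) (height z) = z.
Proof.
rewrite /homog -[RHS]hsubmxK; congr row_mx; apply/rowP => i.
by rewrite (ord1 i) !mxE eqxx.
Qed.

Lemma homogP a x y c c' :
  homog (a *: x + y) (a * c + c') = a *: homog x c + homog y c'.
Proof.
by rewrite /homog scale_row_mx add_row_mx scale_scalar_mx raddfD.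
Qed.

Lemma homog0 : homog 0 0 = 0.
Proof. by rewrite /homog raddf0 row_mx0. Qed.

Lemma homogZ a x c : homog (a *: x) (a * c) = a *: homog x c.
Proof. by have := homogP a x 0 c 0; rewrite homog0 !addr0. Qed.

Lemma homog_sum (K : finType) (w : K -> R) (p : K -> 'rV[R]_d) (c : K -> R) :
  homog (\sum_k w k *: p k) (\sum_k w k * c k) = \sum_k w k *: homog (p k) (c k).
Proof.
elim/big_rec3 : _; first exact: homog0.
by move=> k y1 y2 y3 _ <-; rewrite homogP.
Qed.

Lemma homog_affine (K : finType) (w : K -> R) (p : K -> 'rV[R]_d) :
  \sum_k w k = 1 -> homog (\sum_k w k *: p k) 1 = \sum_k w k *: homog (p k) 1.
Proof.
move=> w1; rewrite -homog_sum -[in LHS]w1; congr homog.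
by apply: eq_bigr => k _; rewrite mulr1.
Qed.

Lemma heightP a z z' : height (a *: z + z') = a * height z + height z'.
Proof. by rewrite /height !mxE. Qed.

Lemma homog_int x c :
  int_lattice (homog x c) <-> int_lattice x /\ c \is a Num.int.
Proof.
split=> [h|[hx hc] i].
  split=> [i|]; first by have := h (lshift 1 i); rewrite row_mxEl.
  by have := h (rshift d ord0); rewrite -/(height _) height_homog.
rewrite mxE; case: splitP => j _; first exact: hx.
by rewrite (ord1 j) mxE eqxx.
Qed.

End Lift.

(** * Generators, slices and interior points of the cone *)

Section PolytopeCone.
Variables (R : realType) (d n q : nat) (P : set 'rV[R]_d).
Variable v : 'I_n -> 'rV[R]_d.
Hypothesis q_gt0 : (0 < q)%N.
Hypothesis PE : forall x, P x <-> exists w : 'I_n -> R,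
  [/\ forall i, 0 <= w i, \sum_i w i = 1 & x = \sum_i w i *: v i].
Hypothesis hdim : has_dim P d.

Definition gens (i : 'I_n) : 'rV[R]_(d + 1) := homog (q%:R *: v i) q%:R.

Let q0 : (q%:R : R) != 0. Proof. by rewrite pnatr_eq0 -lt0n. Qed.

Lemma gensE i : gens i = q%:R *: homog (v i) 1.
Proof. by rewrite -homogZ mulr1. Qed.

Lemma height_sum (K : finType) (w : K -> R) (f : K -> 'rV[R]_(d + 1)) :
  height (\sum_k w k *: f k) = \sum_k w k * height (f k).
Proof.
rewrite /height summxE; apply: eq_bigr => k _.
by rewrite mxE.
Qed.

Lemma height_comb_gens mu : height (comb gens mu) = q%:R * \sum_i mu i.
Proof.
rewrite height_sum mulr_sumr; apply: eq_bigr => i _.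
by rewrite height_homog mulrC.
Qed.

Lemma affine_hull_full x : affine_hull P x.
Proof.
have [p [B [fB ->]]] := hdim; apply: submx_full.
by rewrite row_full_unit -row_free_unit.
Qed.

Lemma gens_span z : exists mu : 'I_n -> R, z = comb gens mu.
Proof.
suff : (z <= \matrix_i gens i)%MS.
  move=> /submxP[D ->]; exists (fun i => D 0 i); rewrite mulmx_sum_row.
  by apply: eq_bigr => i _; rewrite rowK.
have h1 x : (homog x 1 <= \matrix_i gens i)%MS.
  have [m [p [w [Pp w1 ->]]]] := affine_hull_full x.
  rewrite homog_affine //; apply: summx_sub => k _; apply: scalemx_sub.
  have [c [c0 c1 ->]] := (PE _).1 (Pp k).
  rewrite homog_affine //; apply: summx_sub => i _; apply: scalemx_sub.
  have -> : homog (v i) 1 = q%:R^-1 *: row i (\matrix_i gens i).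
    by rewrite rowK gensE scalerA mulVf // scale1r.
  by apply: scalemx_sub; exact: row_sub.
(* Any vector is a linear combination of two vectors of height [1], where full dimensionality of [P]
   applies. *)
have -> : z = (height z - 1) *: homog 0 1 + homog (lsubmx z) 1.
  by rewrite -homogP scaler0 add0r mulr1 subrK homog_lsubmx.
by apply: addmx_sub => //; exact: scalemx_sub.
Qed.

Lemma gens_nonempty : (0 < n)%N.
Proof.
have [mu hmu] := gens_span (homog 0 1).
rewrite lt0n; apply/eqP => n0.
have := height_comb_gens mu; rewrite -hmu height_homog big1 => [/eqP|i _].
  by rewrite mulr0 oner_eq0.
by have := leq_ltn_trans (leq0n i) (ltn_ord i); rewrite lt0n n0 eqxx.
Qed.

Lemma dilate_cone t x : dilate t P x <-> cone gens (homog x t%:R).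
Proof.
split=> [[y Py <-]|[mu mu0 hmu]].
  have [w [w0 w1 ->]] := (PE y).1 Py.
  exists (fun i => t%:R / q%:R * w i).
    by move=> i; rewrite mulr_ge0 // divr_ge0.
  have -> : homog (t%:R *: \sum_i w i *: v i) t%:R =
      t%:R *: \sum_i w i *: homog (v i) 1.
    by rewrite -homog_affine // -homogZ mulr1.
  rewrite scaler_sumr; apply: eq_bigr => i _; rewrite gensE !scalerA.
  by congr (_ *: _); field.
have sum_mu : q%:R * \sum_i mu i = t%:R.
  by rewrite -height_comb_gens -hmu height_homog.
have xE : x = \sum_i (q%:R * mu i) *: v i.
  rewrite -(homogK x t%:R) hmu /comb.
  have -> : \sum_i mu i *: gens i =
      homog (\sum_i mu i *: (q%:R *: v i)) (\sum_i mu i * q%:R).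
    by rewrite homog_sum.
  by rewrite homogK; apply: eq_bigr => i _; rewrite scalerA mulrC.
(* For [t = 0] division by [t] is meaningless; the dilate contains the origin because [P] has a
   point, here [v i0]. *)
have [t0|t0] := eqVneq t 0%N.
  have mu_eq0 i : mu i = 0.
    apply/eqP; have : \sum_i mu i == 0.
      by move: sum_mu; rewrite t0 => /eqP; rewrite mulf_eq0 (negPf q0).
    rewrite psumr_eq0 // => /allP /(_ i); rewrite mem_index_enum.
    by move=> /(_ isT).
  have i0 : 'I_n by exact: (Ordinal gens_nonempty).
  exists (v i0); last first.
    rewrite t0 scale0r xE big1 // => i _.
    by rewrite mu_eq0 mulr0 scale0r.
  apply/PE; exists (fun i => (i == i0)%:R); split => //.
    by rewrite (bigD1 i0) //= eqxx big1 ?addr0 // => i /negPf ->.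
  rewrite (bigD1 i0) //= eqxx scale1r big1 ?addr0 // => i /negPf ->.
  by rewrite scale0r.
have tR : (t%:R : R) != 0 by rewrite pnatr_eq0.
exists (\sum_i (q%:R * mu i / t%:R) *: v i).
  apply/PE; exists (fun i => q%:R * mu i / t%:R); split => //.
    by move=> i; rewrite divr_ge0 // mulr_ge0.
  by rewrite -mulr_suml -mulr_sumr sum_mu divff.
rewrite scaler_sumr xE; apply: eq_bigr => i _; rewrite scalerA.
by congr (_ *: _); field.
Qed.

Lemma finite_cone_slice t :
  finite_set [set z | [/\ cone gens z, int_lattice z & height z = t]].
Proof.
(* The weights in a slice sum to [t / q], so [t / q * K] bounds every coordinate. *)
pose K := \sum_i \sum_j `|gens i 0 j|.
apply: sub_finite_set (finite_int_box (d + 1) (t / q%:R * K)) => z.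
move=> [[mu mu0 zE] Lz hz] j; split; first exact: Lz.
have smu : \sum_i mu i = t / q%:R.
  by rewrite -hz zE height_comb_gens mulrC mulKf.
rewrite zE /comb summxE; apply: le_trans (ler_norm_sum _ _ _) _.
rewrite -smu mulr_suml; apply: ler_sum => i _.
rewrite mxE normrM ger0_norm //; apply: ler_wpM2l => //.
rewrite /K (bigD1 i) //= (bigD1 j) //= -addrA lerDl.
by apply: addr_ge0; repeat (apply: sumr_ge0 => ? _).
Qed.

Lemma lattice_count_cone (t : nat) : (lattice_count P t)%:Z =
  cnt (@int_lattice R (d + 1)) (@height R d) (cone gens) t%:Z.
Proof.
congr Posz; rewrite /lattice_count.
have fS : finite_set (slice (@int_lattice R (d + 1)) (@height R d) (cone gens) t%:Z).
  by apply: sub_finite_set (finite_cone_slice t%:R) => z [? [? ?]].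
have homog_inj : injective (fun x : 'rV[R]_d => homog x t%:R).
  by move=> x y /(congr1 lsubmx); rewrite !homogK.
have im : slice (@int_lattice R (d + 1)) (@height R d) (cone gens) t%:Z =
    (fun x => homog x t%:R) @` (dilate t P `&` int_lattice).
  apply/seteqP; split=> z /=.
    move=> [cz [Lz hz]]; exists (lsubmx z); last by rewrite -[RHS]homog_lsubmx hz.
    have zE : z = homog (lsubmx z) t%:R by rewrite -[LHS]homog_lsubmx hz.
    by split; [apply/dilate_cone; rewrite -zE|move: Lz; rewrite {1}zE => /homog_int[]].
  move=> [x [/dilate_cone cx Lx] <-]; split => //; split.
    by apply/homog_int; split => //; exact: natr_int.
  by rewrite /= height_homog.
rewrite im card_fset_set_image //.
have -> : dilate t P `&` int_lattice = lsubmx @` ((fun x => homog x t%:R) @`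
    (dilate t P `&` int_lattice)).
  apply/seteqP; split=> x.
    by move=> hx; exists (homog x t%:R); rewrite ?homogK //; exists x.
  by move=> [_ [y hy <-] <-]; rewrite homogK.
by rewrite -im; exact: finite_image.
Qed.

(** Interior in the algebraic sense, free of topology: [a] is an order unit of the cone. *)
Definition interior_point (a : 'rV[R]_(d + 1)) :=
  cone gens a /\ forall z, exists2 k, 0 <= k & cone gens (z + k *: a).

Lemma sum_gens_interior : interior_point (comb gens (fun=> 1)).
Proof.
split; first by exists (fun=> 1).
move=> z; have [mu ->] := gens_span z.
exists (\sum_i `|mu i|); first exact: sumr_ge0.
exists (fun i => (\sum_i `|mu i|) * 1 + mu i); last by rewrite combD addrC.
move=> i; rewrite mulr1 (bigD1 i) //= addrAC.
by rewrite addr_ge0 ?sumr_ge0 //; have := ler_norm (- mu i); rewrite normrN; lra.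
Qed.

(** Points of positive depth are interior; with the minimality of [l] this makes [B1] vanish below
    [l]. *)
Lemma interior_point_shift a z c : interior_point a -> 0 < c ->
  cone gens (z - c *: a) -> interior_point z.
Proof.
move=> [ca ia] c0 cz; split.
  by rewrite -(subrK (c *: a) z); apply: coneD => //; apply: coneZ => //; exact: ltW.
move=> y; have [k k0 ck] := ia y; exists (k / c); first by rewrite divr_ge0 // ltW.
have -> : y + (k / c) *: z = y + k *: a + (k / c) *: (z - c *: a).
  rewrite scalerBr scalerA divfK ?gt_eqF // -addrA; congr (_ + _).
  by rewrite addrCA subrr addr0.
by apply: coneD => //; apply: coneZ => //; rewrite divr_ge0 // ltW.
Qed.

End PolytopeCone.

Lemma comb_unlift (R : realFieldType) (V : lmodType R) (n : nat) (a : V)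
    (u : 'I_n -> V) (mu : 'I_n.+1 -> R) :
  comb (fun i => if unlift ord0 i is Some j then u j else a) mu =
  mu ord0 *: a + comb u (fun j => mu (lift ord0 j)).
Proof.
rewrite /comb big_ord_recl unlift_none; congr (_ + _).
by apply: eq_bigr => j _; rewrite liftK.
Qed.

Lemma minimal_interior_point (R : realType) (d n q : nat) (P : set 'rV[R]_d)
    (v : 'I_n -> 'rV[R]_d) :
  (0 < q)%N ->
  (forall x, P x <-> exists w : 'I_n -> R,
    [/\ forall i, 0 <= w i, \sum_i w i = 1 & x = \sum_i w i *: v i]) ->
  has_dim P d -> (forall i, int_lattice (gens q v i)) ->
  exists (l : nat) (a : 'rV[R]_(d + 1)),
    [/\ (0 < l)%N, int_lattice a, height a = l%:R, interior_point q v a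
      & forall z (t : int), int_lattice z -> height z = t%:~R ->
          interior_point q v z -> l%:Z <= t].
Proof.
move=> q0 PE hdim Lu.
pose Q (l : nat) := `[< exists a : 'rV[R]_(d + 1),
  [/\ int_lattice a, height a = l%:R & interior_point q v a] >].
have exQ : exists l, Q l.
  (* The sum of the [n] generators is an interior lattice point. *)
  exists (q * n)%N; apply/asboolP; exists (comb (gens q v) (fun=> 1)); split.
  - move=> j; rewrite summxE; apply: rpred_sum => i _.
    by rewrite scale1r; exact: Lu.
  - by rewrite height_comb_gens sumr_const card_ord natrM.
  - exact: (sum_gens_interior q0 PE hdim).
have ht_ge0 z : interior_point q v z -> 0 <= height z.
  by move=> [[mu mu0 ->] _]; rewrite height_comb_gens mulr_ge0 // sumr_ge0.
have ht_gt0 z : interior_point q v z -> 0 < height z.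
  move=> iz; rewrite lt_neqAle ht_ge0 // andbT eq_sym; apply/eqP => z0.
  (* Otherwise a vector of height [-1] plus a multiple of [z] would lie in the cone, where heights
     are nonnegative. *)
  have [k k0 [mu mu0 hmu]] := iz.2 (homog 0 (-1)).
  have := height_comb_gens q v mu; rewrite -hmu addrC heightP z0 mulr0 add0r.
  rewrite height_homog => h.
  have : 0 <= q%:R * \sum_i mu i by rewrite mulr_ge0 // sumr_ge0.
  by rewrite -h; lra.
have [l /asboolP[a [La ha ia]] lmin] := ex_minnP exQ.
exists l, a; split => //; first by have := ht_gt0 a ia; rewrite ha ltr0n.
move=> z t Lz hz iz; have t0 : 0 <= t by have := ht_ge0 z iz; rewrite hz ler0z.
rewrite -(gez0_abs t0) lez_nat; apply: lmin; apply/asboolP; exists z; split => //.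
by rewrite hz -{1}(gez0_abs t0) pmulrn.
Qed.

(** * Assembly for a rational polytope *)

Theorem theorem4p8 (R : realType) (d : nat) (P : set 'rV[R]_d) (q : nat)
    (h : {poly int}) (s : nat)
    (hP : rational_polytope P) (hdim : has_dim P d)
    (hq : q = denominator P)
    (hh : is_hstar P q h)
    (hs : s = (size h).-1) :
  (forall i : nat, (i < (q * d.+1 - 1) %/ 2)%N ->
     \sum_(j < i.+1) hcoef h ((q * d.+1)%:Z - 1 - j%:Z)
       <= \sum_(j < i.+2) hcoef h j%:Z) /\
  (forall i : nat, (i <= q * d.+1 - 1)%N ->
     \sum_(j < i.+1) hcoef h j%:Z
       <= \sum_(j < i.+1) hcoef h (s%:Z - j%:Z)).
Proof.
have [pP ratP] := hP; have [fV [n [v [vV PE]]]] := polytope_vertices pP.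
have q0 : (0 < q)%N by rewrite hq denominator_gt0.
pose u := gens q v.
have Lu i : int_lattice (u i).
  apply/homog_int; split=> [j|]; last exact: natr_int.
  have [r vr] := ratP _ (vV i) j.
  rewrite mxE hq; have /dvdnP[c ->] := denominator_dvd j fV (vV i).
  by rewrite natrM -mulrA rpredM ?natr_int // (real_denom_int vr).
have [l [a [l0 La ha ia lmin]]] := minimal_interior_point q0 PE hdim Lu.
(* [ord0] carries [a] in the role of [o]; the remaining indices carry the generators. *)
pose e (i : 'I_n.+1) := if unlift ord0 i is Some j then u j else a.
have eE mu : comb e mu = mu ord0 *: a + comb u (fun j => mu (lift ord0 j)).
  exact: comb_unlift.
have coneE : cone e = cone u.
  apply/seteqP; split=> z.
    move=> [mu mu0 ->]; rewrite eE.
    apply: coneD; last by exists (fun j => mu (lift ord0 j)).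
    by apply: coneZ => //; exact: ia.1.
  move=> [mu mu0 ->]; exists (fun i => if unlift ord0 i is Some j then mu j else 0).
    by move=> i; case: unliftP.
  rewrite eE unlift_none scale0r add0r; congr comb.
  by apply: funext => j; rewrite liftK.
have eo : e ord0 = a by rewrite /e unlift_none.
have [||||||||N0 [N1 [B0 [B1 [hN hB0 hB1 [B0p B1p B0s B1s [B0n B1v]]]]]]] :=
    @cone_count_decomposition R _ _ e ord0 (@int_lattice R (d + 1))
    (@height R d) q l d _ _ _ (@heightP R d) _ _ q0 l0.
- by move=> i; rewrite /e; case: unliftP.
- by move=> i; rewrite mxE rpred0.
- by move=> y z Ly Lz i; rewrite !mxE rpredB.
- by move=> i; rewrite /e; case: unliftP => [j _ _|-> /eqP //]; rewrite height_homog.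
- by rewrite eo.
(* As [a] is interior, some [z + k *: a] lies in the cone; this yields the coefficient [- k] at
   [o]. *)
- move=> z; have [k k0 [mu mu0 hz]] := ia.2 z.
  exists (fun i => if unlift ord0 i is Some j then mu j else - k).
    by move=> i; case: unliftP => // -> /eqP.
  rewrite eE unlift_none scaleNr.
  have -> : comb u (fun j => if unlift ord0 (lift ord0 j) is Some j' then mu j' else - k)
      = comb u mu by congr comb; apply: funext => j; rewrite liftK.
  by rewrite -hz addrCA addNr addr0.
- by move=> t; rewrite coneE; exact: finite_cone_slice.
- by move=> S /card_is_basis ->; rewrite addn1.
pose E := cnt (@int_lattice R (d + 1)) (@height R d) (cone e).
have EE (t : nat) : E t%:Z = ehrhart_series P t.
  by rewrite /E coneE -(lattice_count_cone q0 PE hdim).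
have E_lt0 t : t < 0 -> E t = 0.
  move=> t0; apply/eqP/negPn/negP => /cnt_neq0[z []].
  rewrite coneE => -[mu mu0 ->] _; rewrite height_comb_gens => hz.
  have : 0 <= t%:~R :> R by rewrite -hz mulr_ge0 // sumr_ge0.
  by rewrite ler0z leNgt t0.
pose H := hcoef h.
have [sh hE] := hh.
have H_lt0 t : t < 0 -> H t = 0 by case: t.
have HE t : H t = iter d.+1 (diff q) E t.
  case: (ltP t 0) => [t0|]; first by rewrite H_lt0 // iter_diff_lt0.
  by case: t => // t _; rewrite -(series_mul_iter_diff _ _ _ EE E_lt0) hE.
have H_ge t : (q * d.+1)%:Z <= t -> H t = 0.
  case: t => // t; rewrite lez_nat => ht.
  by rewrite /H /= nth_default // (leq_trans sh).
(* [E] is differenced [d + 1] times, while [N0] and [N1] reach [B0] and [B1] after [d]; one [diff q]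
   remains. *)
have HD t : diff l H t = diff q B0 t + diff q B1 t.
  transitivity (diff l (iter d.+1 (diff q) E) t); first by rewrite /diff !HE.
  rewrite -iter_diff_comm (@eq_iter_diff q d.+1 (diff l E) (fun t => N0 t + N1 t)).
    rewrite iter_diffD; congr (_ + _).
      exact: (@eq_iter_diff q 1 _ _ hB0 t).
    exact: (@eq_iter_diff q 1 _ _ hB1 t).
  exact: hN.
have B1_lt t : t < l%:Z -> B1 t = 0.
  move=> tl; apply/eqP/negPn/negP => /B1v[z [Lz hz [c c0]]].
  rewrite coneE eo => cz.
  have := lmin z t Lz hz (interior_point_shift ia c0 cz).
  by rewrite leNgt tl.
have H0 : H 0 = 1.
  rewrite HE -(@series_mul_iter_diff _ _ q d.+1 0 EE E_lt0).
  rewrite /series_mul big_ord1 subn0 /poly_series -horner_coef0.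
  rewrite !hornerE expr0n gtn_eqF // subr0 expr1n mulr1.
  rewrite /ehrhart_series /lattice_count; congr Posz.
  have -> : dilate 0 P `&` int_lattice = [set 0]; last by rewrite fset_set1 cardfs1.
  apply/seteqP; split=> [x [[y _ <-] _]|x ->]; first by rewrite scale0r.
  split; last by move=> i; rewrite mxE rpred0.
  have i0 : 'I_n := Ordinal (gens_nonempty q0 PE hdim).
  by exists (v i0); [exact: (vV i0).1|rewrite scale0r].
have [Hs Hgt] := hstar_codegree l0 H_lt0 H_ge HD B0s B1s B0n B1p B1_lt q0 H0.
(* A negative value of the right side is excluded by [Hs], since [hcoef] is [0] there; otherwise it
   is the index of the last nonzero coefficient. *)
have sE : s%:Z = (q * d.+1)%:Z - l%:Z.
  move: Hs Hgt; case: (_ - _) => // k Hk Hgt; congr Posz.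
  have k1 : (k < size h)%N.
    by rewrite ltnNge; apply/negP => sk; move: Hk; rewrite /H /= nth_default // ltxx.
  have k2 : (size h <= k.+1)%N by apply/leq_sizeP => j kj; exact: (Hgt j%:Z).
  by rewrite hs; lia.
split=> i _; first exact: (hstar_lower l0 H_lt0 H_ge HD B0s B1s B0n B0p).
rewrite sE; exact: (hstar_upper l0 H_lt0 H_ge HD B0s B1s B0n B1p B1_lt).
Qed.
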